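(* Consider a recursive multivariate Gaussian mean estimation process $$\widehat{\boldsymbol\theta}_t=\frac1{n_{t-1}}\sum_{i=1}^{n_{t-1}}\boldsymbol{x}_{t-1,i},\qquad t\ge1,$$ where $\boldsymbol{x}_{t-1,i}\sim N(\widehat{\boldsymbol\theta}_{t-1},\boldsymbol\Sigma)$ for $t\ge2$ and $\boldsymbol{x}_{0,i}\sim N(\boldsymbol\theta^\star,\boldsymbol\Sigma)$. For any $T\ge2$, it holds that $$P(T)=\mathbb{E}_{\boldsymbol X}\left[\Phi\left(-\frac{\|\boldsymbol X\|_2}{2\|\boldsymbol\Sigma^{1/2}\widetilde{\boldsymbol X}_T\|_2}\right)\right],$$ where $\widetilde{\boldsymbol X}_T=\boldsymbol X/\|\boldsymbol X\|_2$ with $\boldsymbol X\sim N\big(\boldsymbol 0,\sum_{t=1}^{T-1}c_t^{-1}\boldsymbol\Sigma\big)$. Let $\lambda_{\min}$ and $\lambda_{\max}$ denote the minimum and maximum eigenvalues of $\boldsymbol\Sigma$, respectively. It then follows that $$\mathbb{E}_{\boldsymbol X}\left[\Phi\left(-\frac{\|\boldsymbol X\|_2}{2\lambda_{\min}}\right)\right]\le P(T)\le\mathbb{E}_{\boldsymbol X}\left[\Phi\left(-\frac{\|\boldsymbol X\|_2}{2\lambda_{\max}}\right)\right].$$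
   Context: Here $\boldsymbol\theta^\star\in\mathbb{R}^p$ is the true mean and $\boldsymbol\Sigma$ is the $p\times p$ covariance matrix used at every step. The sample sizes are $n_0=n$ (the size of the real dataset) and $n_t=c_t\times n$ for $t\ge1$, where $(c_t)_{t\ge1}$ is the sample size schedule. At each step the dataset $\{\boldsymbol x_{t-1,i}\}_{i=1}^{n_{t-1}}$ is drawn i.i.d. from the stated normal distribution (for $t\ge2$, given the previous estimate $\widehat{\boldsymbol\theta}_{t-1}$). The quantity $P(T)=\mathbb{P}\big(\|\widehat{\boldsymbol\theta}_T-\boldsymbol\theta^\star\|_2<\|\widehat{\boldsymbol\theta}_1-\boldsymbol\theta^\star\|_2\big)$ is the probability that the estimate after $T$ recursive steps is strictly closer to the true parameter than the real-data estimate $\widehat{\boldsymbol\theta}_1$. $\Phi(x)=\int_{-\infty}^x\frac1{\sqrt{2\pi}}e^{-t^2/2}\,dt$ is the cumulative distribution function of the standard normal distribution.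
   Formalization: In the two-sided bound λ_min and λ_max are replaced by their square roots, since the bound as printed fails (e.g. p=1, Σ=4, T=2, c_1=1); Σ is taken nonzero and the lower bound is stated for λ_min>0, so that the quotients are defined. *)

(* Defs.v *)
From HB Require Import structures.
From mathcomp Require Import all_boot all_order all_algebra.
From mathcomp Require Import all_classical all_reals all_analysis.
From mathcomp Require Import measurable_realfun.

Set Implicit Arguments.
Unset Strict Implicit.
Unset Printing Implicit Defensive.

Import Order.TTheory GRing.Theory Num.Theory.

Local Open Scope classical_set_scope.
Local Open Scope ring_scope.

Definition cV_display (d : measure_display) : measure_display.
Proof. exact. Qed.

Section cV_measurable.
Context d (T : measurableType d) (n : nat).

Let coord (i : 'I_n) (v : 'cV[T]_n) : T := v i ord0.

Let cV_set0 : g_sigma_preimage coord set0.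
Proof. exact: sigma_algebra0. Qed.

Let cV_setC A : g_sigma_preimage coord A -> g_sigma_preimage coord (~` A).
Proof. exact: sigma_algebraC. Qed.

Let cV_bigcup (F : _^nat) : (forall i, g_sigma_preimage coord (F i)) ->
  g_sigma_preimage coord (\bigcup_i (F i)).
Proof. exact: sigma_algebra_bigcup. Qed.

(* Coordinate-generated sigma-algebra; for T = R it is the Borel one. *)
HB.instance Definition _ := @isMeasurable.Build (cV_display d)
  'cV[T]_n (g_sigma_preimage coord) cV_set0 cV_setC cV_bigcup.

Lemma measurable_coord (i : 'I_n) :
  measurable_fun [set: 'cV[T]_n] (fun v => v i ord0).
Proof.
move=> _ Y mY; rewrite setTI; apply: sub_sigma_algebra => /=.
rewrite -bigcup_seq/=; exists i => /=; first by rewrite mem_index_enum.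
by exists Y => //; rewrite setTI.
Qed.

Lemma measurable_fun_coordP d1 (T1 : measurableType d1) (f : T1 -> 'cV[T]_n) :
  measurable_fun [set: T1] f <->
  forall i, measurable_fun [set: T1] (fun x => f x i ord0).
Proof.
split=> [mf i|mf].
  exact: (measurableT_comp (measurable_coord i) mf).
apply: (@measurability _ _ _ _ _ _ (\big[setU/set0]_(i < n)
  preimage_set_system setT (coord i) measurable)) => //.
move=> _ [B + <-]; rewrite setTI -bigcup_seq/= => -[i _ [A mA <-]].
by rewrite setTI -[X in measurable X]setTI; exact: mf.
Qed.

End cV_measurable.

Section gaussian.
Context {R : realType}.

Definition enorm n (v : 'cV[R]_n) : R := Num.sqrt (\sum_i v i ord0 ^+ 2).

Definition psdmx n (A : 'M[R]_n) : Prop :=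
  A^T = A /\ forall u : 'cV[R]_n, 0 <= (u^T *m A *m u) ord0 ord0.

(* The positive semidefinite square root, which exists and is unique when A is
   positive semidefinite. *)
Definition sqrtmx n (A : 'M[R]_n) : 'M[R]_n :=
  xget 0 [set S | psdmx S /\ S *m S = A].

Definition is_min_eigenvalue n (A : 'M[R]_n) (l : R) : Prop :=
  eigenvalue A l /\ forall m, eigenvalue A m -> l <= m.

Definition is_max_eigenvalue n (A : 'M[R]_n) (l : R) : Prop :=
  eigenvalue A l /\ forall m, eigenvalue A m -> m <= l.

Definition Phi (x : R) : \bar R := normal_prob 0 1 `]-oo, x].

Definition cons_cV n (z : measurableTypeR R * 'cV[R]_n) : 'cV[R]_n.+1 := col_mx z.1%:M z.2.

Lemma measurable_cons_cV n :
  measurable_fun [set: measurableTypeR R * 'cV[R]_n] (@cons_cV n).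
Proof.
apply/measurable_fun_coordP => i; case: (@split_ordP 1 n i) => j ->.
  rewrite (_ : (fun _ => _) = (fun z : measurableTypeR R * 'cV[R]_n => z.1)); first exact: measurable_fst.
  by apply/funext => z; apply: etrans (col_mxEu _ _ _ _) _; rewrite mxE ord1.
rewrite (_ : (fun _ => _) = fun z : measurableTypeR R * 'cV[R]_n => z.2 j ord0); last first.
  by apply/funext => z; exact: col_mxEd.
exact: (measurableT_comp (measurable_coord j) measurable_snd).
Qed.

HB.instance Definition _ n :=
  isMeasurableFun.Build _ _ _ _ (@cons_cV n) (@measurable_cons_cV n).

(* The n-fold product of N(0, 1). *)
Fixpoint std_normal n : probability 'cV[R]_n R :=
  if n is m.+1 then
    distribution (normal_prob 0 1 \x std_normal m)%E (@cons_cV m)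
  else \d_(0%R : 'cV[R]_0).

Definition affine_cV n (mu : 'cV[R]_n) (A : 'M[R]_n) (z : 'cV[R]_n) : 'cV[R]_n :=
  mu + A *m z.

Lemma measurable_affine_cV n (mu : 'cV[R]_n) (A : 'M[R]_n) :
  measurable_fun [set: 'cV[R]_n] (affine_cV mu A).
Proof.
apply/measurable_fun_coordP => i.
under eq_fun do rewrite /affine_cV !mxE.
apply: measurable_funD => //; apply: measurable_sum => j.
by apply: measurable_funM => //; exact: measurable_coord.
Qed.

HB.instance Definition _ n (mu : 'cV[R]_n) (A : 'M[R]_n) :=
  isMeasurableFun.Build _ _ _ _ (affine_cV mu A) (measurable_affine_cV mu A).

(* N(mu, Sigma), as the law of mu + Sigma^(1/2) Z with Z standard normal;
   singular Sigma are allowed. *)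
Definition mvnormal n (mu : 'cV[R]_n) (Sigma : 'M[R]_n) :
    probability 'cV[R]_n R :=
  distribution (std_normal n) (affine_cV mu (sqrtmx Sigma)).

End gaussian.

Section recursive_estimation.
Context {R : realType} {d : measure_display} {Omega : measurableType d}.
Context {p : nat}.
Variables (thetastar : 'cV[R]_p) (N : nat -> nat).
Variable x : nat -> nat -> Omega -> 'cV[R]_p.

(* x t i is the i-th observation of the t-th dataset, relevant for i < N t.
   Estimate 0 is the true mean and estimate t.+1 is the mean of dataset t. *)
Definition estimate (t : nat) (w : Omega) : 'cV[R]_p :=
  if t is s.+1 then (N s)%:R^-1 *: \sum_(i < N s) x s i w else thetastar.

(* The sigma-algebra generated by the datasets 0, ..., t - 1. *)
Definition past (t : nat) : set (set Omega) :=
  <<s [set E | exists s i B, [/\ (s < t)%N, (i < N s)%N,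
                                 measurable B & E = x s i @^-1` B]] >>.

(* The last clause is the defining property of the conditional distribution:
   given all the previous datasets, the observations of dataset t are
   independent with law N(estimate t, Sigma). *)
Definition recursive_gaussian_process (P : probability Omega R)
    (Sigma : 'M[R]_p) : Prop :=
  (forall t i, (i < N t)%N -> measurable_fun [set: Omega] (x t i)) /\
  (forall t (H : set Omega) (B : nat -> set 'cV[R]_p),
     past t H -> (forall i, measurable (B i)) ->
     (P (H `&` [set w | forall i, (i < N t)%N -> B i (x t i w)]) =
      \int[P]_(w in H)
        \prod_(i < N t) mvnormal (estimate t w) Sigma (B i))%E).

Definition prob_improvement (P : probability Omega R) (T : nat) : \bar R :=
  P [set w | enorm (estimate T w - thetastar) <
             enorm (estimate 1 w - thetastar)].

End recursive_estimation.

(* Main.v *)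
Require Import Defs.
From HB Require Import structures.
From mathcomp Require Import all_boot all_order all_algebra.
From mathcomp Require Import ring lra.
From mathcomp Require Import all_classical all_reals all_analysis.
From mathcomp Require Import measurable_realfun.

(** With [S] the square root of [Sigma], estimate [t + 1] minus estimate [t] is,
given the past, distributed as [(N t)^(-1/2) S Z].  Independent centred Gaussian
increments add up, so (estimate 1, estimate [T]) has the law of
[thetastar + (a S Z1, a S Z1 + b S Z2)] for independent standard normal [Z1] and
[Z2], where [a = n^(-1/2)], [b = k a] and [k ^ 2 = \sum_(1 <= t < T) 1 / c t].
Thus [k S Z2] has the law of [X].  Expanding the squared norms, estimate [T] is
closer to [thetastar] iff [<Z1, S u> < - k |u| ^ 2 / 2] for [u = S Z2].  Given
[Z2] this has probability [Phi (- k |u| ^ 2 / (2 |S u|))], which is the integrand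
at [X = k u], provided that [S Z2 != 0], which holds almost surely because
[Sigma != 0].  The two bounds are the Rayleigh quotient bounds for [Sigma]. *)

Set Implicit Arguments.
Unset Strict Implicit.
Unset Printing Implicit Defensive.

Import Order.TTheory GRing.Theory Num.Theory.

Local Open Scope classical_set_scope.
Local Open Scope ring_scope.

Definition pack_mfun d d' (X : measurableType d) (Y : measurableType d')
    (f : X -> Y) (mf : measurable_fun setT f) : {mfun X >-> Y} :=
  HB.pack f (isMeasurableFun.Build _ _ _ _ f mf).

Lemma measurable_preimageT d1 d2 (X : measurableType d1) (Y : measurableType d2)
    (f : X -> Y) (B : set Y) :
  measurable_fun setT f -> measurable B -> measurable [set x | B (f x)].
Proof. by move=> mf mB; rewrite -[X in measurable X]setTI; exact: mf. Qed.

Lemma xsectionE T1 T2 (C : set (T1 * T2)) x : xsection C x = [set y | C (x, y)].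
Proof. by apply/seteqP; split=> y /=; rewrite /xsection/= inE. Qed.

Lemma measurable_section d1 d2 (X : measurableType d1) (Y : measurableType d2)
    (R : realType) (m : {sigma_finite_measure set Y -> \bar R}) (C : set (X * Y)) :
  measurable C -> measurable_fun setT (fun x => m [set y | C (x, y)]).
Proof.
move=> mC; under eq_fun do rewrite -xsectionE.
exact: (measurable_fun_xsection m mC).
Qed.

Lemma probability_cst d (X : measurableType d) (R : realType)
    (P : probability X R) (Y : Type) (A : set Y) (y : Y) :
  P [set _ | A y] = (\1_A y)%:E.
Proof.
rewrite indicE; have [Ay|nAy] := pselect (A y).
  by rewrite mem_set// -(@probability_setT _ _ _ P); congr (P _); apply/seteqP; split.
have -> : [set _ : X | A y] = set0 by apply/seteqP; split=> // ? /nAy.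
by rewrite memNset// measure0.
Qed.

Section gaussian_line.
Context {R : realType}.
Notation mu := (@lebesgue_measure R).
Notation RR := (measurableTypeR R).

Lemma measurable_affine (m s : R) :
  measurable_fun setT ((fun x => m + s * x) : RR -> RR).
Proof. by apply: measurable_funD => //; exact: measurable_funM. Qed.

Lemma lebesgue_measure_affine (m s : R) (A : set RR) : s != 0 -> measurable A ->
  (mu A = `|s|%:E * mu ((fun x => m + s * x)%R @^-1` A))%E.
Proof.
move=> s0 mA.
have mf := measurable_affine m s.
pose f := @pack_mfun _ _ RR RR _ mf : {mfun RR >-> RR}.
have nns : 0 <= `|s| by [].
rewrite (@lebesgue_measure_unique R (mscale (NngNum nns) (pushforward mu f)))//.
move=> _ [[a b]] _ <-; rewrite /mscale/= /pushforward lebesgue_measure_itv/=.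
have [s_gt0|s_lt0|] := ltgtP 0 s; last by move/esym/eqP; rewrite (negbTE s0).
- transitivity (`|s|%:E * mu [set` `](a - m) / s, (b - m) / s]%R])%E; last first.
    congr (_ * mu _)%E; rewrite /preimage; apply/seteqP; split=> x /=;
      by rewrite !in_itv/= ltr_pdivrMr// ler_pdivlMr// ltrBlDl lerBrDl mulrC.
  rewrite lebesgue_measure_itv/= !lte_fin ltr_pM2r ?invr_gt0// ltrD2r.
  case: ifPn => _; last by rewrite mule0.
  by rewrite gtr0_norm// -!EFinD -EFinM; congr EFin; field.
- transitivity (`|s|%:E * mu [set` `[(b - m) / s, (a - m) / s[%R])%E; last first.
    congr (_ * mu _)%E; rewrite /preimage; apply/seteqP; split=> x /=;
      by rewrite !in_itv/= ltr_ndivlMr// ler_ndivrMr// ltrBlDl lerBrDl mulrC andbC.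
  rewrite lebesgue_measure_itv/= !lte_fin ltr_nM2r ?invr_lt0// ltrD2r.
  case: ifPn => _; last by rewrite mule0.
  by rewrite ltr0_norm// -!EFinD -EFinM; congr EFin; field.
Qed.

Lemma normal_prob_affine (m s : R) (A : set RR) : s != 0 -> measurable A ->
  normal_prob 0 1 ((fun x => m + s * x) @^-1` A) = normal_prob m s A.
Proof.
move=> s0 mA; have mf := measurable_affine m s.
pose f := @pack_mfun _ _ RR RR _ mf : {mfun RR >-> RR}.
have nns : 0 <= `|s| by [].
have mpdf : measurable_fun setT (fun x : RR => (normal_pdf m s x)%:E).
  by apply/measurable_EFinP; exact: measurable_normal_pdf.
rewrite [RHS]/normal_prob.
rewrite (@eq_measure_integral _ _ _ _
  (mscale (NngNum nns) (pushforward mu f)) mu); last first.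
  by move=> B mB _; exact: lebesgue_measure_affine.
rewrite ge0_integral_mscale//; last 2 first.
- exact: measurable_funTS.
- by move=> x _; rewrite lee_fin normal_pdf_ge0.
have mfA : measurable (f @^-1` A) by exact: (measurable_preimageT mf mA).
rewrite ge0_integral_pushforward//; last 2 first.
- exact: measurable_funTS.
- by move=> x _; rewrite lee_fin normal_pdf_ge0.
rewrite /= -ge0_integralZl//; last 2 first.
- by apply: (measurableT_comp mpdf); apply: measurable_funTS.
- by move=> x _; rewrite lee_fin normal_pdf_ge0.
apply: eq_integral => x _ /=; rewrite -EFinM; congr EFin.
rewrite !normal_pdfE// ?oner_neq0// /normal_peak /normal_fun expr1n mul1r.
rewrite mulrA; congr (_ * expR _); last by field.
rewrite -mulrnAr sqrtrM ?sqr_ge0// sqrtr_sqr invfM mulrA divff ?mul1r//.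
by rewrite normr_eq0.
Qed.

Lemma ge0_integral_normal_prob (m s : R) (f : RR -> \bar R) :
  measurable_fun setT f -> (forall x, 0 <= f x)%E ->
  (\int[normal_prob m s]_x f x = \int[mu]_x (f x * (normal_pdf m s x)%:E))%E.
Proof.
move=> mf f0.
have dom := normal_prob_dominates m s.
rewrite -(Radon_Nikodym_SigmaFinite.change_of_variables dom)//.
have mpdf : measurable_fun setT (fun x : RR => (normal_pdf m s x)%:E).
  by apply/measurable_EFinP; exact: measurable_normal_pdf.
have iRN := Radon_Nikodym_SigmaFinite.f_integrable dom.
apply: ae_eq_integral => //.
- by apply: emeasurable_funM => //; exact: measurable_int iRN.
- exact: emeasurable_funM.
- apply: ae_eqe_mul2l; apply: integral_ae_eq => //=.
  by move=> E _ mE; rewrite -Radon_Nikodym_SigmaFinite.f_integral.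
Qed.

Lemma ge0_integral_gauss_affine (m s : R) (f : RR -> \bar R) : s != 0 ->
  measurable_fun setT f -> (forall x, 0 <= f x)%E ->
  (\int[normal_prob 0 1]_x f (m + s * x)%R = \int[normal_prob m s]_x f x)%E.
Proof.
move=> s0 mfun f0; have mf := measurable_affine m s.
pose g := @pack_mfun _ _ RR RR _ mf : {mfun RR >-> RR}.
rewrite -(@eq_measure_integral _ _ _ _ (normal_prob m s)
  (distribution (normal_prob 0 1) g)).
  by rewrite ge0_integral_distribution.
by move=> A mA _; exact: normal_prob_affine.
Qed.

(* Completing the square in [x]: the second factor on the right integrates to 1. *)
Lemma normal_pdf_mul (a b x z : R) : a != 0 -> b != 0 ->
  normal_pdf 0 a x * normal_pdf x b z =
  normal_pdf 0 (Num.sqrt (a ^+ 2 + b ^+ 2)) z *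
  normal_pdf (a ^+ 2 * z / (a ^+ 2 + b ^+ 2))
    (a * b / Num.sqrt (a ^+ 2 + b ^+ 2)) x.
Proof.
move=> a0 b0.
have a2 : 0 < a ^+ 2 by rewrite exprn_even_gt0.
have b2 : 0 < b ^+ 2 by rewrite exprn_even_gt0.
have r2 : 0 < a ^+ 2 + b ^+ 2 by rewrite addr_gt0.
have r0 : Num.sqrt (a ^+ 2 + b ^+ 2) != 0 by rewrite gt_eqF// sqrtr_gt0.
rewrite !normal_pdfE//; last by rewrite !mulf_neq0// invr_neq0.
rewrite /normal_peak /normal_fun mulrACA [RHS]mulrACA -!expRD !exprMn !exprVn.
rewrite sqr_sqrtr ?ltW//; congr (_ * expR _); last first.
  field; rewrite a0 b0 (gt_eqF r2)//=.
have h (u : R) : 0 < u -> 0 <= u * pi *+ 2.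
  by move=> u0; rewrite pmulrn_lge0// mulr_ge0 ?ltW ?pi_gt0.
rewrite -!invfM -!sqrtrM ?h//; congr (Num.sqrt _)^-1; field.
by rewrite (gt_eqF r2).
Qed.

Lemma normal_prob_norm (m s : R) (B : set RR) :
  normal_prob m `|s| B = normal_prob m s B.
Proof.
rewrite /normal_prob; apply: eq_integral => x _.
by rewrite /normal_pdf /normal_peak /normal_fun normr_eq0 real_normK ?num_real.
Qed.

Lemma normal_prob_scale_norm (s : R) (B : set RR) : measurable B ->
  normal_prob 0 1 [set x | B (`|s| * x)] = normal_prob 0 1 [set x | B (s * x)].
Proof.
move=> mB; have [->|s0] := eqVneq s 0; first by rewrite normr0.
have e c : [set x | B (c * x)] = (fun x => 0 + c * x) @^-1` B.
  by apply/funext => x; rewrite /= add0r.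
have ns0 : `|s| != 0 by rewrite normr_eq0.
by rewrite !e (normal_prob_affine 0 ns0 mB) (normal_prob_affine 0 s0 mB) normal_prob_norm.
Qed.

Lemma measurable_normal_pdf2 (b : R) : b != 0 ->
  measurable_fun setT (fun z : RR * RR => normal_pdf z.1 b z.2).
Proof.
move=> b0; under eq_fun do rewrite normal_pdfE//.
apply: measurable_funM => //; apply: measurableT_comp => //.
apply: measurable_funM => //; apply: measurableT_comp => //.
by apply: measurable_funX; apply: measurable_funB.
Qed.

Lemma measurable_normal_prob_mean (s : R) (B : set RR) : s != 0 -> measurable B ->
  measurable_fun setT (fun x : RR => normal_prob x s B).
Proof.
move=> s0 mB; under eq_fun do rewrite -normal_prob_affine//.
have mf : measurable_fun setT (fun z : RR * RR => z.1 + s * z.2).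
  by apply: measurable_funD => //; exact: measurable_funM.
apply: (@measurable_section _ _ _ _ _ (normal_prob 0 1)
  ((fun z : RR * RR => z.1 + s * z.2) @^-1` B)).
exact: measurable_preimageT.
Qed.

Lemma gauss_conv (a b : R) (B : set RR) : measurable B ->
  (\int[normal_prob 0 1]_x normal_prob 0 1 [set y | B (a * x + b * y)%R] =
  normal_prob 0 1 [set x | B (Num.sqrt (a ^+ 2 + b ^+ 2) * x)%R])%E.
Proof.
move=> mB; have [->|a0] := eqVneq a 0.
  under eq_integral do under eq_set do rewrite mul0r add0r.
  rewrite integral_cst//= probability_setT mule1 expr0n add0r sqrtr_sqr.
  by rewrite normal_prob_scale_norm.
have [->|b0] := eqVneq b 0.
  under eq_integral do under eq_set do rewrite mul0r addr0.
  rewrite expr0n addr0 sqrtr_sqr normal_prob_scale_norm//.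
  transitivity (\int[normal_prob 0 1]_x (\1_[set x | B (a * x)%R] x)%:E)%E.
    apply: eq_integral => x _.
    exact: (probability_cst _ [set x | B (a * x)]).
  rewrite integral_indic ?setIT//.
  have mf : measurable_fun setT (fun x : RR => a * x) by exact: measurable_funM.
  exact: measurable_preimageT.
have a2 : 0 < a ^+ 2 by rewrite exprn_even_gt0.
have b2 : 0 < b ^+ 2 by rewrite exprn_even_gt0.
have r2 : 0 < a ^+ 2 + b ^+ 2 by rewrite addr_gt0.
set r := Num.sqrt _.
have r0 : r != 0 by rewrite gt_eqF// sqrtr_gt0.
transitivity (\int[normal_prob 0 1]_x normal_prob (0 + a * x)%R b B)%E.
  by apply: eq_integral => x _; rewrite add0r -(normal_prob_affine (a * x) b0).
have mN := measurable_normal_prob_mean b0 mB.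
rewrite (@ge0_integral_gauss_affine 0 a (fun u => normal_prob u b B))//.
rewrite ge0_integral_normal_prob//.
have mp m s : measurable_fun setT (fun x : RR => (normal_pdf m s x)%:E).
  by apply/measurable_EFinP; exact: measurable_normal_pdf.
transitivity (\int[mu]_x \int[mu]_z
    (normal_pdf 0 a x * normal_pdf x b z * \1_B z)%:E)%E.
  apply: eq_integral => x _; rewrite muleC /normal_prob -ge0_integralZl//.
  - rewrite integral_mkcond; apply: eq_integral => z _.
    by rewrite epatch_indic.
  - exact: measurable_funTS.
  - by move=> z _; rewrite lee_fin normal_pdf_ge0.
  - by rewrite lee_fin normal_pdf_ge0.
rewrite (fubini_tonelli (fun z : RR * RR =>
  (normal_pdf 0 a z.1 * normal_pdf z.1 b z.2 * \1_B z.2)%:E)) /=; last 2 first.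
- apply/measurable_EFinP; apply: measurable_funM => //; last first.
    have mI : measurable_fun setT (\1_B : RR -> R) by exact: measurable_indic.
    exact: (measurableT_comp mI measurable_snd).
  apply: measurable_funM; last exact: measurable_normal_pdf2.
  exact: (measurableT_comp (measurable_normal_pdf 0 a) measurable_fst).
- by move=> z; rewrite lee_fin !mulr_ge0 ?normal_pdf_ge0.
under eq_integral do under eq_integral do rewrite normal_pdf_mul//.
transitivity (\int[mu]_(z in B) (normal_pdf 0 r z)%:E)%E.
  rewrite [RHS]integral_mkcond; apply: eq_integral => z _; rewrite epatch_indic.
  under eq_integral do rewrite mulrAC EFinM.
  rewrite ge0_integralZl//.
  - by rewrite integral_normal_pdf mule1.
  - by move=> x _; rewrite lee_fin normal_pdf_ge0.
  - by rewrite lee_fin mulr_ge0 ?normal_pdf_ge0.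
rewrite -/(normal_prob 0 r B) -normal_prob_affine//.
by congr (normal_prob 0 1); apply/funext => x /=; rewrite add0r.
Qed.

End gaussian_line.

Section gaussian_vector.
Context {R : realType}.
Notation RR := (measurableTypeR R).
Notation gauss := (normal_prob 0 1 : probability RR R).

Lemma cons_cV0 n (z : RR * 'cV[R]_n) : cons_cV z ord0 ord0 = z.1.
Proof.
have -> : ord0 = lshift n (ord0 : 'I_1) by exact: val_inj.
by apply: etrans (col_mxEu _ _ _ _) _; rewrite mxE.
Qed.

Lemma cons_cVS n (z : RR * 'cV[R]_n) i : cons_cV z (lift ord0 i) ord0 = z.2 i ord0.
Proof.
have -> : lift ord0 i = rshift 1 i by exact: val_inj.
exact: col_mxEd.
Qed.

Lemma integral_prob_cst d (X : measurableType d) (P : probability X R)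
  (c : \bar R) : (\int[P]_x c = c)%E.
Proof. by rewrite integral_cst//= probability_setT mule1. Qed.

Lemma scaleD_cons_cV n (a b : R) (x y : RR) (z w : 'cV[R]_n) :
  a *: cons_cV (x, z) + b *: cons_cV (y, w) =
  cons_cV (a * x + b * y, a *: z + b *: w).
Proof.
have e m (A B : 'cV[R]_m) i : (a *: A + b *: B) i ord0 = a * A i ord0 + b * B i ord0.
  by rewrite !mxE.
apply/matrixP => i j; rewrite (ord1 j) e.
have [k ->|->] := unliftP ord0 i; last by rewrite !cons_cV0.
by rewrite !cons_cVS/= e.
Qed.

Section measurability.
Context d (X : measurableType d).

Lemma measurable_cVD n (f g : X -> 'cV[R]_n) : measurable_fun setT f ->
  measurable_fun setT g -> measurable_fun setT (fun x => f x + g x).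
Proof.
move=> /measurable_fun_coordP mf /measurable_fun_coordP mg.
apply/measurable_fun_coordP => i; under eq_fun do rewrite mxE.
exact: measurable_funD.
Qed.

Lemma measurable_mulmx m n (A : 'M[R]_(m, n)) (f : X -> 'cV[R]_n) :
  measurable_fun setT f -> measurable_fun setT (fun x => A *m f x).
Proof.
move=> /measurable_fun_coordP mf.
apply/measurable_fun_coordP => i; under eq_fun do rewrite mxE.
by apply: measurable_sum => j; exact: measurable_funM.
Qed.

Lemma measurable_cVZ n (a : R) (f : X -> 'cV[R]_n) :
  measurable_fun setT f -> measurable_fun setT (fun x => a *: f x).
Proof.
by move=> mf; under eq_fun do rewrite -mul_scalar_mx; exact: measurable_mulmx.
Qed.

Lemma measurable_cV_sum n (I : Type) (s : seq I) (P : pred I)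
    (f : I -> X -> 'cV[R]_n) : (forall i, P i -> measurable_fun setT (f i)) ->
  measurable_fun setT (fun x => \sum_(i <- s | P i) f i x).
Proof.
move=> mf; elim: s => [|i s IH].
  by under eq_fun do rewrite big_nil; exact: measurable_cst.
have [Pi|/negbTE nPi] := boolP (P i).
  under eq_fun do rewrite big_cons Pi.
  by apply: measurable_cVD => //; exact: mf.
by under eq_fun do rewrite big_cons nPi.
Qed.

Lemma measurable_fun_cons_cV n (f : X -> RR) (g : X -> 'cV[R]_n) :
  measurable_fun setT f -> measurable_fun setT g ->
  measurable_fun setT (fun x => cons_cV (f x, g x)).
Proof.
move=> mf mg; apply: (measurableT_comp (@measurable_cons_cV R n)).
exact: measurable_fun_pair.
Qed.

End measurability.

Lemma ge0_integral_std_normalS n (f : 'cV[R]_n.+1 -> \bar R) :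
  measurable_fun setT f -> (forall z, 0 <= f z)%E ->
  (\int[std_normal n.+1]_z f z =
   \int[gauss]_x \int[std_normal n]_z f (cons_cV (x, z)))%E.
Proof.
move=> mf f0; rewrite ge0_integral_distribution//.
rewrite (fubini_tonelli1 (f \o @cons_cV R n))//; last by move=> z; exact: f0.
exact: (measurableT_comp mf (@measurable_cons_cV R n)).
Qed.

Lemma ge0_integral_image2 d1 d2 d3 d4 (X : measurableType d1)
    (Y : measurableType d2) (W : measurableType d3) (Z : measurableType d4)
    (P : probability X R) (Q : probability Y R) (M : probability W R)
    (g : X * Y -> Z) (h : W -> Z) :
  measurable_fun setT g -> measurable_fun setT h ->
  (forall B, measurable B ->
    (\int[P]_x Q [set y | B (g (x, y))] = M [set w | B (h w)])%E) ->
  forall f : Z -> \bar R, measurable_fun setT f -> (forall z, 0 <= f z)%E ->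
  (\int[P]_x \int[Q]_y f (g (x, y)) = \int[M]_w f (h w))%E.
Proof.
move=> mg mh gh f mf f0.
have mfg : measurable_fun setT (f \o g) by exact: measurableT_comp.
have fg0 z : (0 <= (f \o g) z)%E by exact: f0.
rewrite -(fubini_tonelli1 (f \o g) mfg fg0).
rewrite -(@ge0_integral_distribution _ _ _ _ _ (P \x Q)%E (pack_mfun mg))//.
rewrite -(@ge0_integral_distribution _ _ _ _ _ M (pack_mfun mh))//.
apply: eq_measure_integral => B mB _.
apply: etrans (gh B mB); apply: eq_integral => x _.
by rewrite /= xsectionE.
Qed.

Lemma ge0_integral_gauss_conv (a b : R) (f : RR -> \bar R) :
  measurable_fun setT f -> (forall x, 0 <= f x)%E ->
  (\int[gauss]_x \int[gauss]_y f (a * x + b * y)%R =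
   \int[gauss]_x f (Num.sqrt (a ^+ 2 + b ^+ 2) * x)%R)%E.
Proof.
pose g (z : RR * RR) : RR := a * z.1 + b * z.2.
apply: (@ge0_integral_image2 _ _ _ _ _ _ _ _ gauss gauss gauss g).
- by apply: measurable_funD; apply: measurable_funM.
- exact: measurable_funM.
- by move=> B mB; exact: gauss_conv.
Qed.

Lemma ge0_integral_std_normal_conv n (a b : R) (f : 'cV[R]_n -> \bar R) :
  measurable_fun setT f -> (forall x, 0 <= f x)%E ->
  (\int[std_normal n]_x \int[std_normal n]_y f (a *: x + b *: y)%R =
   \int[std_normal n]_x f (Num.sqrt (a ^+ 2 + b ^+ 2) *: x)%R)%E.
Proof.
elim: n f => [|n IH] f mf f0.
  have e (z : 'cV[R]_0) : f z = f 0 by rewrite (flatmx0 z).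
  under eq_integral do under eq_integral do rewrite e.
  under [RHS]eq_integral do rewrite e.
  by rewrite !integral_prob_cst.
set r := Num.sqrt _.
have mcons d (X : measurableType d) (g : X -> RR) (h : X -> 'cV[R]_n) :
    measurable_fun setT g -> measurable_fun setT h ->
    measurable_fun setT (fun p => f (cons_cV (g p, h p))).
  by move=> mg mh; apply: (measurableT_comp mf); exact: measurable_fun_cons_cV.
pose F x y z w := f (cons_cV (a * x + b * y, a *: z + b *: w)).
transitivity (\int[gauss]_x \int[std_normal n]_z \int[gauss]_y
    \int[std_normal n]_w F x y z w)%E.
  have mint : measurable_fun setT
      (fun z : 'cV[R]_n.+1 => \int[std_normal n.+1]_w f (a *: z + b *: w)%R)%E.
    apply: (measurable_fun_fubini_tonelli_F
      (fun p : 'cV[R]_n.+1 * 'cV[R]_n.+1 => f (a *: p.1 + b *: p.2))) => //.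
    by apply: (measurableT_comp mf); apply: measurable_cVD; exact: measurable_cVZ.
  have int0 (z : 'cV[R]_n.+1) :
      (0 <= \int[std_normal n.+1]_w f (a *: z + b *: w)%R)%E.
    exact: integral_ge0.
  rewrite (ge0_integral_std_normalS mint int0).
  apply: eq_integral => x _; apply: eq_integral => z _.
  have mfz : measurable_fun setT
      (fun w : 'cV[R]_n.+1 => f (a *: cons_cV (x, z) + b *: w)).
    by apply: (measurableT_comp mf); apply: measurable_cVD => //; exact: measurable_cVZ.
  rewrite (ge0_integral_std_normalS mfz) => [|w]; last exact: f0.
  by apply: eq_integral => y _; apply: eq_integral => w _; rewrite scaleD_cons_cV.
transitivity (\int[gauss]_x \int[gauss]_y \int[std_normal n]_z
    \int[std_normal n]_w F x y z w)%E.
  apply: eq_integral => x _.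
  rewrite (fubini_tonelli (fun p : 'cV[R]_n * RR =>
    \int[std_normal n]_w F x p.2 p.1 w)%E)//.
  - apply: (measurable_fun_fubini_tonelli_F
      (fun p : ('cV[R]_n * RR) * 'cV[R]_n => F x p.1.2 p.1.1 p.2)) => [|q]; last exact: f0.
    apply: mcons.
      apply: measurable_funD => //; apply: measurable_funM => //.
      exact: (measurableT_comp measurable_snd measurable_fst).
    apply: measurable_cVD; apply: measurable_cVZ => //.
    exact: (measurableT_comp measurable_fst measurable_fst).
  - by move=> p; apply: integral_ge0 => w _; exact: f0.
transitivity (\int[gauss]_x \int[gauss]_y \int[std_normal n]_z
    f (cons_cV (a * x + b * y, r *: z)%R))%E.
  apply: eq_integral => x _; apply: eq_integral => y _.
  by rewrite (IH (fun v => f (cons_cV (a * x + b * y, v))))//; exact: mcons.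
rewrite (@ge0_integral_gauss_conv a b (fun u =>
  \int[std_normal n]_z f (cons_cV (u, r *: z)))%E)//; last 2 first.
- apply: (measurable_fun_fubini_tonelli_F
      (fun p : RR * 'cV[R]_n => f (cons_cV (p.1, r *: p.2)))) => //.
  by apply: mcons => //; exact: measurable_cVZ.
- by move=> u; apply: integral_ge0.
have mfr : measurable_fun setT (fun z : 'cV[R]_n.+1 => f (r *: z)).
  by apply: (measurableT_comp mf); exact: measurable_cVZ.
rewrite (ge0_integral_std_normalS mfr) => [|w]; last exact: f0.
apply: eq_integral => x _; apply: eq_integral => z _; congr f.
have := scaleD_cons_cV r 0 x x z z.
by rewrite !scale0r !addr0 mul0r addr0 => ->.
Qed.

Lemma enormS n (a : 'cV[R]_n.+1) : enorm a =
  Num.sqrt (a ord0 ord0 ^+ 2 + enorm (\col_i a (lift ord0 i) ord0) ^+ 2).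
Proof.
rewrite /enorm sqr_sqrtr; last by apply: sumr_ge0 => i _; rewrite sqr_ge0.
by rewrite big_ord_recl; congr (Num.sqrt (_ + _)); apply: eq_bigr => i _; rewrite mxE.
Qed.

Lemma ge0_integral_std_normal_dot n (a : 'cV[R]_n) (f : RR -> \bar R) :
  measurable_fun setT f -> (forall x, 0 <= f x)%E ->
  (\int[std_normal n]_z f (\sum_i a i ord0 * z i ord0)%R =
   \int[gauss]_x f (enorm a * x)%R)%E.
Proof.
elim: n a f => [|n IH] a f mf f0.
  under eq_integral do rewrite big_ord0.
  by under [RHS]eq_integral do rewrite /enorm big_ord0 sqrtr0 mul0r;
    rewrite !integral_prob_cst.
have mdot m (u : 'cV[R]_m) : measurable_fun setT
    (fun z : 'cV[R]_m => \sum_i u i ord0 * z i ord0).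
  apply: measurable_sum => i; apply: measurable_funM => //.
  exact: measurable_coord.
have mfa := measurableT_comp mf (mdot _ a).
rewrite (ge0_integral_std_normalS mfa) => [|w]; last exact: f0.
pose a' := \col_i a (lift ord0 i) ord0.
transitivity (\int[gauss]_x \int[gauss]_y f (a ord0 ord0 * x + enorm a' * y)%R)%E.
  apply: eq_integral => x _.
  rewrite -(IH a' (fun y => f (a ord0 ord0 * x + y)))//; last first.
    by apply: (measurableT_comp mf); exact: measurable_funD.
  apply: eq_integral => z _; congr f.
  rewrite big_ord_recl cons_cV0; congr (_ + _).
  by apply: eq_bigr => i _; rewrite cons_cVS mxE.
by rewrite ge0_integral_gauss_conv// enormS.
Qed.

End gaussian_vector.

Section mixture.
Context d d1 d2 (X : measurableType d) (Q : measurableType d1)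
  (Z : measurableType d2) (R : realType).
Variables (mu : {measure set X -> \bar R}) (M : probability Q R).
Variables (D : set X) (g : X * Q -> Z) (W : X -> \bar R).
Hypotheses (mD : measurable D) (mg : measurable_fun setT g)
  (mW : measurable_fun setT W) (W0 : forall x, (0 <= W x)%E)
  (Wfin : forall x, W x \is a fin_num).

Definition mixture (C : set Z) : \bar R :=
  (\int[mu]_(x in D) (M [set q | C (g (x, q))] * W x))%E.

Lemma measurable_mixture_kernel C : measurable C ->
  measurable_fun setT (fun x => M [set q | C (g (x, q))]).
Proof.
move=> mC; apply: (measurable_section M (C := g @^-1` C)).
exact: measurable_preimageT.
Qed.

Let mixture0 : mixture set0 = 0%E.
Proof. by apply: integral0_eq => x _; rewrite measure0 mul0e. Qed.

Let mixture_ge0 C : (0 <= mixture C)%E.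
Proof. by apply: integral_ge0 => x _; rewrite mule_ge0. Qed.

Let mixture_sigma_additive : semi_sigma_additive mixture.
Proof.
move=> U mU tU mUU; rewrite [X in _ --> X](_ : _ =
  \int[mu]_(x in D) (\sum_(n <oo) (M [set q | U n (g (x, q))] * W x)))%E; last first.
  apply: eq_integral => x _.
  have mgx : measurable_fun setT (fun q => g (x, q)) by exact: measurable_fun_pair2.
  under eq_eseriesr do rewrite muleC.
  rewrite -(fineK (Wfin x)) nneseriesZl// muleC; congr (_ * _)%E.
  apply/esym/cvg_lim => //.
  exact: (measure_semi_sigma_additive (s := pushforward M (pack_mfun mgx))).
apply/cvg_closeP; split.
  by apply: is_cvg_nneseries => n _ _; exact: mixture_ge0.
rewrite closeE// integral_nneseries// => n.
  apply: emeasurable_funM; apply: measurable_funTS => //.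
  exact: measurable_mixture_kernel.
by move=> x _; rewrite mule_ge0.
Qed.

HB.instance Definition _ := isMeasure.Build _ _ _ mixture
  mixture0 mixture_ge0 mixture_sigma_additive.

Definition mixture_measure : {measure set Z -> \bar R} := mixture.

End mixture.

Lemma measure_eq_rectangles d1 d2 (X : measurableType d1) (Y : measurableType d2)
    (R : realType) (m1 m2 : {measure set (X * Y) -> \bar R}) :
  (m1 setT < +oo)%E ->
  (forall A B, measurable A -> measurable B -> m1 (A `*` B) = m2 (A `*` B)) ->
  forall C, measurable C -> m1 C = m2 C.
Proof.
move=> m1oo m12 C mC.
pose G : set (set (X * Y)) :=
  [set C | exists A, measurable A /\ exists B, measurable B /\ C = A `*` B].
apply: (measure_unique G (fun=> setT)) => //.
- rewrite measurable_prod_measurableType //; congr (<<s _ >>).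
  rewrite predeqE; split => [[A mA [B mB <-]]|[A [mA [B [mB ->]]]]].
    by exists A; split => //; exists B.
  by exists A => //; exists B.
- move=> /= _ _ [X1 [mX1 [X2 [mX2 ->]]]] [Y1 [mY1 [Y2 [mY2 ->]]]].
  rewrite -setXI; exists (X1 `&` Y1); split; first exact: measurableI.
  by exists (X2 `&` Y2); split => //; exact: measurableI.
- by move=> _; exists setT; split => //; exists setT; rewrite setXTT.
- exact: bigcup_const.
- by move=> _ [A [mA [B [mB ->]]]]; exact: m12.
Qed.

Section quadratic_forms.
Context {R : realType}.

Definition bform n (A : 'M[R]_n) (u v : 'cV[R]_n) : R :=
  (u^T *m A *m v) ord0 ord0.

Lemma bformDr n (A : 'M[R]_n) u v w : bform A u (v + w) = bform A u v + bform A u w.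
Proof. by rewrite /bform mulmxDr mxE. Qed.

Lemma bformZr n (A : 'M[R]_n) c u v : bform A u (c *: v) = c * bform A u v.
Proof. by rewrite /bform -scalemxAr mxE. Qed.

Lemma bformC n (A : 'M[R]_n) u v : A^T = A -> bform A u v = bform A v u.
Proof.
move=> sA; have -> : bform A u v = (u^T *m A *m v)^T ord0 ord0 by rewrite mxE.
by rewrite !trmx_mul trmxK sA mulmxA.
Qed.

Lemma bformDl n (A : 'M[R]_n) u v w : bform A (u + v) w = bform A u w + bform A v w.
Proof. by rewrite /bform linearD/= !mulmxDl mxE. Qed.

Lemma bformZl n (A : 'M[R]_n) c u v : bform A (c *: u) v = c * bform A u v.
Proof. by rewrite /bform linearZ/= -!scalemxAl mxE. Qed.

Lemma bformBm n (A B : 'M[R]_n) u v : bform (A - B) u v = bform A u v - bform B u v.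
Proof. by rewrite /bform mulmxBr mulmxBl !mxE. Qed.

Lemma bformDm n (A B : 'M[R]_n) u v : bform (A + B) u v = bform A u v + bform B u v.
Proof. by rewrite /bform mulmxDr mulmxDl mxE. Qed.

Lemma bformNm n (A : 'M[R]_n) u v : bform (- A) u v = - bform A u v.
Proof. by rewrite /bform mulmxN mulNmx mxE. Qed.

Lemma bformZm n c (A : 'M[R]_n) u v : bform (c *: A) u v = c * bform A u v.
Proof. by rewrite /bform -scalemxAr -scalemxAl mxE. Qed.

Lemma bform_mulr n (A B : 'M[R]_n) u v : bform A u (B *m v) = bform (A *m B) u v.
Proof. by rewrite /bform !mulmxA. Qed.

Lemma bform_mull n (A B : 'M[R]_n) u v : bform A (B *m u) v = bform (B^T *m A) u v.
Proof. by rewrite /bform trmx_mul !mulmxA. Qed.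

Lemma bform1E n (u v : 'cV[R]_n) : bform 1%:M u v = \sum_i u i ord0 * v i ord0.
Proof. by rewrite /bform mulmx1 mxE; apply: eq_bigr => i _; rewrite mxE. Qed.

Lemma bformE n (A : 'M[R]_n) u v :
  bform A u v = \sum_j (\sum_i u i ord0 * A i j) * v j ord0.
Proof.
rewrite /bform mxE; apply: eq_bigr => j _; rewrite mxE; congr (_ * _).
by apply: eq_bigr => i _; rewrite mxE.
Qed.

Lemma bform_delta n (A : 'M[R]_n) i j :
  bform A (delta_mx i ord0) (delta_mx j ord0) = A i j.
Proof. by rewrite /bform trmx_delta -rowE -colE !mxE. Qed.

Lemma bform1_ge0 n (u : 'cV[R]_n) : 0 <= bform 1%:M u u.
Proof. by rewrite bform1E sumr_ge0// => i _; rewrite -expr2 sqr_ge0. Qed.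

Lemma bform1_eq0 n (u : 'cV[R]_n) : bform 1%:M u u = 0 -> u = 0.
Proof.
rewrite bform1E => /eqP; rewrite psumr_eq0; last by move=> i _; rewrite -expr2 sqr_ge0.
move=> /allP h; apply/matrixP => i j; rewrite (ord1 j) mxE.
by have := h i (mem_index_enum _); rewrite -expr2 sqrf_eq0 => /eqP.
Qed.

Lemma bform1_gt0 n (u : 'cV[R]_n) : u != 0 -> 0 < bform 1%:M u u.
Proof.
by move=> u0; rewrite lt_def bform1_ge0 andbT; apply: contra u0 => /eqP/bform1_eq0 ->.
Qed.

Lemma enorm_sqr n (u : 'cV[R]_n) : enorm u ^+ 2 = bform 1%:M u u.
Proof.
rewrite /enorm sqr_sqrtr ?bform1E; first by apply: eq_bigr => i _; rewrite expr2.
by apply: sumr_ge0 => i _; rewrite sqr_ge0.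
Qed.

Lemma psd_cauchy_schwarz n (A : 'M[R]_n) u v : psdmx A ->
  bform A u v ^+ 2 <= bform A u u * bform A v v.
Proof.
move=> [sA pA].
have key x y : 0 <= bform A y y * (bform A x x * bform A y y - bform A x y ^+ 2).
  have := pA (bform A y y *: x + - bform A x y *: y); rewrite -/(bform A _ _).
  rewrite !(bformDl, bformDr, bformZl, bformZr) (bformC y x sA).
  by congr (0 <= _); ring.
have [v0|v0] := ltrP 0 (bform A v v).
  by have := key u v; rewrite pmulr_rge0// subr_ge0.
have [u0|u0] := ltrP 0 (bform A u u).
  by have := key v u; rewrite pmulr_rge0// subr_ge0 (bformC v u sA) mulrC.
have vv : bform A v v = 0 by apply/eqP; rewrite eq_le v0; exact: pA.
have uu : bform A u u = 0 by apply/eqP; rewrite eq_le u0; exact: pA.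
have := pA (u + - bform A u v *: v); rewrite -/(bform A _ _).
rewrite !(bformDl, bformDr, bformZl, bformZr) (bformC v u sA) uu vv => h.
have := sqr_ge0 (bform A u v); rewrite mulr0; move: h; set b := bform A u v => h1 h2.
nra.
Qed.

Lemma psd_bform_eq0 n (A : 'M[R]_n) u : psdmx A -> bform A u u = 0 -> A *m u = 0.
Proof.
move=> pA u0; apply: bform1_eq0.
rewrite bform_mulr mul1mx; apply/eqP; rewrite -sqrf_eq0.
have := psd_cauchy_schwarz (A *m u) u pA; rewrite u0 mulr0 => h.
by apply/eqP/le_anti; rewrite h sqr_ge0.
Qed.

Lemma psd_eq0 n (A : 'M[R]_n) : psdmx A -> (forall u, bform A u u = 0) -> A = 0.
Proof.
move=> pA A0; apply/matrixP => i j; rewrite mxE -bform_delta /bform -mulmxA.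
by rewrite (psd_bform_eq0 pA (A0 _)) mulmx0 mxE.
Qed.

Lemma bform_bounded n (A : 'M[R]_n) :
  exists2 K, 0 < K & forall u, bform A u u <= K * bform 1%:M u u.
Proof.
exists (1 + \sum_j \sum_i `|A i j|).
  by rewrite ltr_pwDl// sumr_ge0// => j _; rewrite sumr_ge0.
move=> u; rewrite bformE mulrDl mul1r.
have entry i : u i ord0 ^+ 2 <= bform 1%:M u u.
  rewrite bform1E (bigD1 i)//= -expr2 lerDl sumr_ge0// => k _.
  by rewrite -expr2 sqr_ge0.
apply: ler_wpDl; first exact: bform1_ge0.
rewrite mulr_suml; apply: ler_sum => j _.
rewrite !mulr_suml; apply: ler_sum => i _.
apply: le_trans (ler_norm _) _; rewrite !normrM -mulrA mulrCA mulrA mulrC.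
rewrite mulrCA ler_wpM2l//.
have := entry i; have := entry j; rewrite -(real_normK (num_real (u i ord0))).
rewrite -(real_normK (num_real (u j ord0))) => h1 h2.
have := sqr_ge0 (`|u i ord0| - `|u j ord0|); rewrite sqrrB => h3.
lra.
Qed.

(* With [l] the supremum of the form on the unit sphere, [l - A] is positive
   semidefinite; if it were invertible, Cauchy-Schwarz would bound its form
   below by a positive multiple of the squared norm, contradicting the supremum. *)
Lemma rayleigh_max n (A : 'M[R]_n.+1) : A^T = A ->
  exists2 l, eigenvalue A l & forall u, bform A u u <= l * bform 1%:M u u.
Proof.
move=> sA; have [K K0 AK] := bform_bounded A.
pose E := [set bform A u u | u in [set u | bform 1%:M u u = 1]].
have supE : has_sup E.
  split.
    exists (bform A (delta_mx ord0 ord0) (delta_mx ord0 ord0)).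
    by exists (delta_mx ord0 ord0) => //=; rewrite bform_delta mxE eqxx.
  by exists K => _ [u /= u1 <-]; rewrite (le_trans (AK u))// u1 mulr1.
pose l := sup E; have lub u : bform A u u <= l * bform 1%:M u u.
  have [->|u0] := eqVneq u 0; first by rewrite /bform !mulmx0 mxE mulr0.
  have uu := bform1_gt0 u0; pose c := Num.sqrt (bform 1%:M u u).
  have c0 : 0 < c by rewrite sqrtr_gt0.
  have c2 : bform 1%:M u u = c ^+ 2 by rewrite sqr_sqrtr// ltW.
  have : bform A (c^-1 *: u) (c^-1 *: u) <= l.
    apply: ub_le_sup; first by case: supE.
    exists (c^-1 *: u) => //=; rewrite bformZl bformZr c2 expr2.
    by rewrite mulKf ?gt_eqF// mulVf// gt_eqF.
  rewrite bformZl bformZr mulrA -invfM -expr2 -c2 mulrC.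
  by rewrite ler_pdivrMr.
exists l => //; apply/negP => nl.
pose B := l%:M - A.
have pB : psdmx B.
  split=> [|u]; first by rewrite /B linearB/= tr_scalar_mx sA.
  by rewrite -/(bform B u u) bformBm -[l%:M]scalemx1 bformZm subr_ge0.
have uA : A - l%:M \in unitmx.
  by rewrite -row_free_unit -kermx_eq0.
pose C := - invmx (A - l%:M).
have BC : B *m C = 1%:M.
  by rewrite /B /C -opprB mulmxN mulNmx opprK mulmxV.
have [M M0 CM] := bform_bounded C^T.
have Bge u : bform 1%:M u u <= M * bform B u u.
  have [->|u0] := eqVneq u 0; first by rewrite /bform !mulmx0 mxE mulr0.
  have uu := bform1_gt0 u0.
  rewrite -(ler_pM2r uu) -expr2.
  have := psd_cauchy_schwarz u (C *m u) pB.
  rewrite 2!bform_mulr BC bform_mull mulmx1 => /le_trans; apply.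
  rewrite (mulrC M) -mulrA ler_wpM2l//; exact: (pB.2 u).
have : l <= l - M^-1.
  apply: ge_sup; first by case: supE.
  move=> _ [u /= u1 <-]; have := Bge u.
  rewrite /B bformBm -[l%:M]scalemx1 bformZm u1 mulr1 (mulrC M) -ler_pdivrMr// div1r.
  by move=> h; lra.
by rewrite lerBrDl gerDr invr_le0 leNgt M0.
Qed.

Lemma eigenvalueN n (A : 'M[R]_n) l : eigenvalue (- A) l -> eigenvalue A (- l).
Proof.
move=> /eigenvalueP[v vA v0]; apply/eigenvalueP; exists v => //.
by rewrite scaleNr -vA mulmxN opprK.
Qed.

Lemma sym_eigenvector n (A : 'M[R]_n) l : A^T = A -> eigenvalue A l ->
  exists2 u : 'cV[R]_n, u != 0 & A *m u = l *: u.
Proof.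
move=> sA /eigenvalueP[v vA v0]; exists v^T; first by rewrite trmx_eq0.
by rewrite -{1}sA -trmx_mul vA linearZ.
Qed.

Lemma sym_nonzero_eigenvalue n (A : 'M[R]_n) : A^T = A -> A != 0 ->
  exists2 l, l != 0 & eigenvalue A l.
Proof.
case: n A => [|n] A sA A0; first by rewrite (flatmx0 A) eqxx in A0.
have sNA : (- A)^T = - A by rewrite linearN/= sA.
have [l lA Al] := rayleigh_max sA; have [m mA Am] := rayleigh_max sNA.
have [l0|l0] := eqVneq l 0; last by exists l.
have [m0|m0] := eqVneq m 0; last first.
  by exists (- m); rewrite ?oppr_eq0//; exact: eigenvalueN.
exfalso; move/eqP: A0; apply.
have q0 u : bform A u u = 0.
  apply/eqP; rewrite eq_le -[X in _ && X]oppr_le0 -bformNm.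
  by have := Al u; have := Am u; rewrite l0 m0 !mul0r => -> ->.
by apply: psd_eq0 => //; split=> // u; rewrite -/(bform A u u) q0.
Qed.

Lemma bform_outer n (v u w : 'cV[R]_n) :
  bform (v *m v^T) u w = bform 1%:M u v * bform 1%:M v w.
Proof.
rewrite /bform !mulmx1 mulmxA -mulmxA [u^T *m v]mx11_scalar.
by rewrite mul_scalar_mx [LHS]mxE [in RHS]mxE eqxx mulr1n.
Qed.

Lemma bform_eigenvector n (A : 'M[R]_n) l (u v : 'cV[R]_n) : A *m v = l *: v ->
  bform A u v = l * bform 1%:M u v.
Proof. by move=> Av; rewrite -bformZr -Av bform_mulr mul1mx. Qed.

Lemma psd_rank1_deflation n (A : 'M[R]_n) l (v : 'cV[R]_n) : psdmx A -> 0 < l ->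
  bform 1%:M v v = 1 -> A *m v = l *: v -> psdmx (A - l *: (v *m v^T)).
Proof.
move=> pA l0 v1 Av; split=> [|u].
  by rewrite linearB linearZ/= trmx_mul trmxK pA.1.
rewrite -/(bform _ u u) bformBm bformZm subr_ge0.
have := psd_cauchy_schwarz u v pA.
rewrite !(bform_eigenvector _ Av) v1 mulr1 bform_outer (bformC v u (trmx1 _ _)).
set b := bform 1%:M u v; move=> h; rewrite -(ler_pM2r l0).
by have -> : l * (b * b) * l = (l * b) ^+ 2 by ring.
Qed.

(* Subtracting [l v v^T] for a unit eigenvector [v] lowers the rank; the root
   of the remainder kills [v], so adding [sqrt l v v^T] to it gives a root. *)
Lemma psd_sqrt_exists n (A : 'M[R]_n) : psdmx A ->
  exists S, psdmx S /\ S *m S = A.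
Proof.
have [m] := ubnP (\rank A); elim: m n A => // m IH n A rA pA.
have [->|A0] := eqVneq A 0.
  exists 0; split; last by rewrite mulmx0.
  by split=> [|u]; rewrite ?trmx0// mulmx0 mul0mx mxE.
have [l l0 lA] := sym_nonzero_eigenvalue pA.1 A0.
have [w w0 Aw] := sym_eigenvector pA.1 lA.
have ww := bform1_gt0 w0; pose c := (Num.sqrt (bform 1%:M w w))^-1.
have [v v1 Av] : exists2 v, bform 1%:M v v = 1 & A *m v = l *: v.
  exists (c *: w); last by rewrite -scalemxAr Aw scalerA mulrC -scalerA.
  rewrite bformZl bformZr mulrA /c -invfM -expr2 sqr_sqrtr; last exact: ltW.
  by rewrite mulVf// gt_eqF.
have {}l0 : 0 < l.
  rewrite lt_def l0 -[l]mulr1 -v1 -(bform_eigenvector _ Av).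
  exact: (pA.2 v).
pose A' := A - l *: (v *m v^T).
have pA' : psdmx A' by exact: psd_rank1_deflation.
have vv : v^T *m v = 1%:M by rewrite [LHS]mx11_scalar -[v^T]mulmx1 -/(bform _ v v) v1.
have A'v : A' *m v = 0.
  by rewrite mulmxBl Av -scalemxAl -mulmxA vv mulmx1 subrr.
have vA : v^T *m A = l *: v^T by rewrite -{1}pA.1 -trmx_mul Av linearZ.
have rA' : (\rank A' < \rank A)%N.
  have A'A : (A' <= A)%MS.
    have -> : A' = (1%:M - v *m v^T) *m A by rewrite mulmxBl mul1mx -mulmxA vA -scalemxAr.
    exact: submxMl.
  rewrite ltn_neqAle (mxrankS A'A) andbT (mxrank_leqif_sup A'A).
  apply/negP => /submxP[M AM]; move: v1; suff -> : v = 0.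
    by rewrite /bform mulmx0 mxE => /esym/eqP; rewrite oner_eq0.
  have /eqP : l *: v = 0 by rewrite -Av AM -mulmxA A'v mulmx0.
  by rewrite scaler_eq0 (gt_eqF l0) => /eqP.
have [S' [pS' S'S']] := IH _ A' (leq_trans rA' rA) pA'.
have S'v : S' *m v = 0.
  apply: bform1_eq0; rewrite bform_mulr bform_mull mul1mx pS'.1 S'S'.
  by rewrite /bform -mulmxA A'v mulmx0 mxE.
have vS' : v^T *m S' = 0 by rewrite -[S']pS'.1 -trmx_mul S'v trmx0.
exists (S' + Num.sqrt l *: (v *m v^T)); split.
  split=> [|u]; first by rewrite linearD linearZ/= trmx_mul trmxK pS'.1.
  rewrite -/(bform _ u u) bformDm bformZm bform_outer (bformC v u (trmx1 _ _)).
  by rewrite addr_ge0 ?(pS'.2 u)// mulr_ge0 ?sqrtr_ge0// -expr2 sqr_ge0.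
rewrite mulmxDl !mulmxDr S'S' -!scalemxAl -!scalemxAr scalerA -expr2 sqr_sqrtr ?ltW//.
rewrite (mulmxA S') S'v mul0mx scaler0 addr0 -(mulmxA v v^T S') vS' mulmx0 scaler0.
by rewrite add0r mulmxA -(mulmxA v) vv mulmx1 subrK.
Qed.

(* [S (S - T) + (S - T) T = 0]; evaluated at an eigenvector [u] of [S - T] with
   nonzero eigenvalue, this forces [S u = T u = 0]. *)
Lemma psd_sqrt_unique n (S T : 'M[R]_n) : psdmx S -> psdmx T ->
  S *m S = T *m T -> S = T.
Proof.
move=> pS pT ST; apply/eqP; rewrite -subr_eq0; apply/negPn/negP => D0.
have sD : (S - T)^T = S - T by rewrite linearB/= pS.1 pT.1.
have [l l0 lD] := sym_nonzero_eigenvalue sD D0.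
have [u u0 Du] := sym_eigenvector sD lD.
have : bform (S *m (S - T) + (S - T) *m T) u u = 0.
  by rewrite mulmxBr mulmxBl ST addrA subrK subrr /bform mulmx0 mul0mx mxE.
rewrite bformDm -bform_mulr Du bformZr -[S - T]sD -bform_mull.
rewrite Du bformZl -mulrDr => /eqP; rewrite mulf_eq0 (negbTE l0)/=.
rewrite paddr_eq0 ?(pS.2 u) ?(pT.2 u)// => /andP[/eqP Su /eqP Tu].
move: Du; rewrite mulmxBl (psd_bform_eq0 pS Su) (psd_bform_eq0 pT Tu) subrr.
by move/esym/eqP; rewrite scaler_eq0 (negbTE l0) (negbTE u0).
Qed.

Lemma sqrtmxP n (A : 'M[R]_n) : psdmx A ->
  psdmx (sqrtmx A) /\ sqrtmx A *m sqrtmx A = A.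
Proof.
move=> pA; rewrite /sqrtmx; case: xgetP => // h.
by have [S /h] := psd_sqrt_exists pA.
Qed.

Lemma sqrtmxZ n c (A : 'M[R]_n) : 0 <= c -> psdmx A ->
  sqrtmx (c *: A) = Num.sqrt c *: sqrtmx A.
Proof.
move=> c0 pA; have psdZ a (B : 'M[R]_n) : 0 <= a -> psdmx B -> psdmx (a *: B).
  move=> a0 pB; split=> [|u]; first by rewrite linearZ/= pB.1.
  by rewrite -/(bform _ u u) bformZm mulr_ge0// (pB.2 u).
have [pS SS] := sqrtmxP pA; have [pT TT] := sqrtmxP (psdZ _ _ c0 pA).
apply: psd_sqrt_unique => //; first by apply: psdZ; rewrite ?sqrtr_ge0.
by rewrite TT -scalemxAl -scalemxAr scalerA -expr2 sqr_sqrtr// SS.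
Qed.

Lemma bform_le_max_eigenvalue n (A : 'M[R]_n) l u : A^T = A ->
  is_max_eigenvalue A l -> bform A u u <= l * bform 1%:M u u.
Proof.
case: n A u => [|n] A u sA [_ lmax]; first by rewrite (flatmx0 u) /bform !mulmx0 mxE mulr0.
have [m /lmax ml /(_ u)/le_trans] := rayleigh_max sA; apply.
by rewrite ler_wpM2r// bform1_ge0.
Qed.

Lemma bform_ge_min_eigenvalue n (A : 'M[R]_n) l u : A^T = A ->
  is_min_eigenvalue A l -> l * bform 1%:M u u <= bform A u u.
Proof.
move=> sA [lA lmin]; rewrite -lerN2 -mulNr -bformNm.
apply: bform_le_max_eigenvalue; first by rewrite linearN/= sA.
split; first by apply: eigenvalueN; rewrite opprK.
by move=> m /eigenvalueN/lmin; rewrite lerNr.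
Qed.

End quadratic_forms.

Lemma integral_indic_comp d1 d2 (X : measurableType d1) (Y : measurableType d2)
    (R : realType) (m : {measure set X -> \bar R}) (f : X -> Y) (B : set Y) :
  measurable_fun setT f -> measurable B ->
  (\int[m]_x (\1_B (f x))%:E = m [set x | B (f x)])%E.
Proof.
move=> mf mB; have mfB : measurable (f @^-1` B).
  exact: measurable_preimageT.
rewrite -[RHS]/(m (f @^-1` B)) -[f @^-1` B]setIT -integral_indic//.
Qed.

Lemma product_measure_swap d1 d2 (X : measurableType d1) (Y : measurableType d2)
    (R : realType) (P : probability X R) (Q : probability Y R) (C : set (X * Y)) :
  measurable C -> ((P \x Q) C = \int[Q]_y P [set x | C (x, y)])%E.
Proof.
move=> mC.
have mI : measurable_fun setT (fun q : X * Y => (\1_C q : R)%:E).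
  by apply/measurable_EFinP; exact: measurable_indic.
have I0 (q : X * Y) : (0 <= (\1_C q : R)%:E)%E by rewrite lee_fin.
rewrite -[C in LHS]setIT -integral_indic// (fubini_tonelli2 _ mI I0).
apply: eq_integral => y _; rewrite /fubini_G.
by rewrite (integral_indic_comp P (f := fun x => (x, y))).
Qed.

Lemma std_normal_conv {R : realType} n (a b : R) (B : set 'cV[R]_n) : measurable B ->
  (std_normal n \x std_normal n)%E [set q | B (a *: q.1 + b *: q.2)] =
  std_normal n [set z | B (Num.sqrt (a ^+ 2 + b ^+ 2) *: z)].
Proof.
move=> mB.
have mI : measurable_fun setT (fun v : 'cV[R]_n => (\1_B v : R)%:E).
  by apply/measurable_EFinP; exact: measurable_indic.
have I0 (v : 'cV[R]_n) : (0 <= (\1_B v : R)%:E)%E by rewrite lee_fin.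
have mr : measurable_fun setT (fun z : 'cV[R]_n => Num.sqrt (a ^+ 2 + b ^+ 2) *: z).
  exact: measurable_cVZ.
rewrite -(integral_indic_comp (std_normal n) mr mB).
rewrite -(ge0_integral_std_normal_conv a b mI I0).
apply: eq_integral => x _ /=; rewrite xsectionE.
rewrite (integral_indic_comp (std_normal n) (f := fun y => a *: x + b *: y))//.
by apply: measurable_cVD => //; exact: measurable_cVZ.
Qed.

Section conditional_mean.
Context {R : realType} d (Omega : measurableType d) (P : probability Omega R).
Context (p : nat) (S : 'M[R]_p) (H : set Omega) (theta : Omega -> 'cV[R]_p).
Context (N : nat) (x : nat -> Omega -> 'cV[R]_p).
Hypotheses (mH : measurable H) (mtheta : measurable_fun setT theta).
Hypothesis mx : forall i, (i < N)%N -> measurable_fun setT (x i).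
Let draw w B := std_normal p [set z | B (theta w + S *m z)].
Hypothesis hx : forall B : nat -> set 'cV[R]_p, (forall i, measurable (B i)) ->
  (P (H `&` [set w | forall i, (i < N)%N -> B i (x i w)]) =
   \int[P]_(w in H) \prod_(i < N) draw w (B i))%E.

Let measurable_rest k (B : nat -> set 'cV[R]_p) : (forall i, measurable (B i)) ->
  measurable (H `&` [set w | forall i, (k <= i < N)%N -> B i (x i w)]).
Proof.
move=> mB; apply: measurableI => //.
rewrite [X in measurable X](_ : _ =
    \bigcap_(i in [set i | (k <= i < N)%N]) x i @^-1` B i)//.
apply: bigcap_measurableType => i /andP[_ iN].
exact: (measurable_preimageT (mx iN)).
Qed.

Let measurable_draw B : measurable B -> measurable_fun setT (fun w => draw w B).
Proof.
move=> mB; apply: (measurable_section (std_normal p)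
  (C := [set q : Omega * 'cV[R]_p | B (theta q.1 + S *m q.2)])).
have mf : measurable_fun setT (fun q : Omega * 'cV[R]_p => theta q.1 + S *m q.2).
  apply: measurable_cVD; first exact: (measurableT_comp mtheta measurable_fst).
  exact: measurable_mulmx.
exact: measurable_preimageT.
Qed.

Let draw_fin w B : measurable B -> draw w B \is a fin_num.
Proof.
move=> mB; apply: fin_num_measure.
have mf : measurable_fun setT (fun z : 'cV[R]_p => theta w + S *m z).
  by apply: measurable_cVD => //; exact: measurable_mulmx.
exact: measurable_preimageT.
Qed.

(* The draws from [k] on stay constrained by [B], so that draw [k] can join the
   sum in the induction step: equality on rectangles extends to all measurable
   sets, in particular to conditions on the sum of the two components. *)
Lemma sum_draws k A (B : nat -> set 'cV[R]_p) : (k <= N)%N -> measurable A ->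
  (forall i, measurable (B i)) ->
  (P (H `&` [set w | forall i, (k <= i < N)%N -> B i (x i w)] `&`
      [set w | A (\sum_(i < k) x i w)%R]) =
  \int[P]_(w in H)
   (std_normal p [set z | A (k%:R *: theta w + S *m (Num.sqrt k%:R *: z))%R] *
    \prod_(k <= i < N) draw w (B i)))%E.
Proof.
elim: k A B => [|k IH] A B kN mA mB.
  under [X in _ `&` X]eq_set do rewrite big_ord0.
  under eq_integral do under eq_set do rewrite scale0r sqrtr0 scale0r mulmx0 addr0.
  under eq_integral do rewrite probability_cst indicE.
  have [A0|A0] := pselect (A 0).
    rewrite (_ : [set _ | A 0] = setT) ?setIT; last by apply/seteqP; split.
    rewrite mem_set//=; under eq_integral do rewrite mul1e big_mkord.
    exact: hx.
  rewrite (_ : [set _ | A 0] = set0); last by apply/seteqP; split=> // ? /A0.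
  rewrite setI0 measure0 memNset//=.
  by under eq_integral do rewrite mul0e; rewrite integral0.
pose G := H `&` [set w | forall i, (k.+1 <= i < N)%N -> B i (x i w)].
have mG : measurable G by exact: measurable_rest.
pose pair_sum w := (\sum_(i < k) x i w, x k w).
have mpair : measurable_fun setT pair_sum.
  apply: measurable_fun_pair; last exact: mx.
  apply: measurable_cV_sum => i _; apply: mx.
  by rewrite (leq_trans (ltn_ord i))// ltnW.
pose m1 := pushforward (mrestr P mG) pair_sum.
pose g (q : Omega * ('cV[R]_p * 'cV[R]_p)) :=
  (k%:R *: theta q.1 + S *m (Num.sqrt k%:R *: q.2.1), theta q.1 + S *m q.2.2).
have mth : measurable_fun setT (fun q : Omega * ('cV[R]_p * 'cV[R]_p) => theta q.1).
  exact: (measurableT_comp mtheta measurable_fst).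
have mg : measurable_fun setT g.
  apply: measurable_fun_pair; apply: measurable_cVD => //.
  - exact: measurable_cVZ.
  - apply: measurable_mulmx; apply: measurable_cVZ.
    exact: (measurableT_comp measurable_fst measurable_snd).
  - apply: measurable_mulmx.
    exact: (measurableT_comp measurable_snd measurable_snd).
pose W w := (\prod_(k.+1 <= i < N) draw w (B i))%E.
have mW : measurable_fun setT W.
  rewrite /W; elim: (index_iota _ _) => [|i s IHs].
    by under eq_fun do rewrite big_nil; exact: measurable_cst.
  under eq_fun do rewrite big_cons.
  by apply: emeasurable_funM => //; exact: measurable_draw.
have W0 w : (0 <= W w)%E by exact: prode_ge0.
have Wfin w : W w \is a fin_num.
  apply: (big_ind (fun y => y \is a fin_num)) => // [y z|i _].
    exact: fin_numM.
  exact: draw_fin.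
pose m2 := mixture_measure P (std_normal p \x std_normal p)%E mH mg mW W0 Wfin.
have m12 C : measurable C -> m1 C = m2 C.
  rewrite /m1; apply: measure_eq_rectangles => //.
    rewrite /= /pushforward /mrestr preimage_setT setTI.
    by rewrite (le_lt_trans (probability_le1 P mG))// ltry.
  move=> A' B' mA' mB'.
  have mB'' i : measurable (if i == k then B' else B i) by case: ifP.
  have := IH A' (fun i => if i == k then B' else B i) (ltnW kN) mA' mB''.
  rewrite /m2 /mixture_measure /= => h; apply: etrans (etrans h _).
    congr (P _); apply/seteqP; split=> w /=.
      move=> [[Aw Bw] [Hw Gw]]; split=> //; split=> // i.
      case: eqVneq => [->//|ik] /andP[ki iN]; apply: Gw.
      by rewrite ltn_neqAle eq_sym ik ki.
    move=> [[Hw Gw] Aw]; split.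
      by split=> //; have := Gw k; rewrite eqxx leqnn; exact.
    split=> // i /andP[ki iN]; have := Gw i; rewrite (gtn_eqF ki); apply.
    by rewrite ltnW.
  apply: eq_integral => w _; rewrite big_ltn// eqxx muleA.
  rewrite (_ : [set q | _] =
    [set z | A' (k%:R *: theta w + S *m (Num.sqrt k%:R *: z))] `*`
     [set z | B' (theta w + S *m z)])//.
  congr (_ * _)%E; last first.
    by apply: eq_big_nat => i /andP[ki _]; rewrite (gtn_eqF ki).
  apply/esym/product_measure1E.
  - have mf : measurable_fun setT (fun z : 'cV[R]_p =>
        k%:R *: theta w + S *m (Num.sqrt k%:R *: z)).
      by apply: measurable_cVD => //; apply: measurable_mulmx; exact: measurable_cVZ.
    exact: measurable_preimageT.
  - have mf : measurable_fun setT (fun z : 'cV[R]_p => theta w + S *m z).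
      by apply: measurable_cVD => //; exact: measurable_mulmx.
    exact: measurable_preimageT.
have mC : measurable [set q : 'cV[R]_p * 'cV[R]_p | A (q.1 + q.2)].
  have mD : measurable_fun setT (fun q : 'cV[R]_p * 'cV[R]_p => q.1 + q.2).
    exact: measurable_cVD.
  exact: measurable_preimageT.
have := m12 _ mC.
rewrite /m1 /m2 /mixture_measure /= => h; apply: etrans (etrans h _).
  rewrite /pushforward /mrestr setIC; congr (P (_ `&` _)).
  by apply/funext => w /=; rewrite big_ord_recr.
apply: eq_integral => w _; congr (_ * _)%E.
pose A1 := [set v | A (k.+1%:R *: theta w + S *m v)].
have mA1 : measurable A1.
  have mf : measurable_fun setT (fun z : 'cV[R]_p => k.+1%:R *: theta w + S *m z).
    by apply: measurable_cVD => //; exact: measurable_mulmx.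
  exact: measurable_preimageT.
have := std_normal_conv (Num.sqrt k%:R) 1 mA1.
rewrite sqr_sqrtr ?ler0n// expr1n natr1 => <-.
congr (product_measure1 _ _ _); apply/funext => q /=; rewrite /A1/=; congr (A _).
by rewrite scale1r mulmxDr -natr1 scalerDl scale1r addrACA.
Qed.

Lemma mean_draws A : (0 < N)%N -> measurable A ->
  (P (H `&` [set w | A (N%:R^-1 *: \sum_(i < N) x i w)%R]) =
  \int[P]_(w in H)
    std_normal p [set z | A (theta w + (Num.sqrt N%:R)^-1 *: (S *m z))%R])%E.
Proof.
move=> N0 mA; have N0' : (N%:R : R) != 0 by rewrite pnatr_eq0 -lt0n.
have mA' : measurable [set v : 'cV[R]_p | A (N%:R^-1 *: v)].
  have mf : measurable_fun setT (fun v : 'cV[R]_p => N%:R^-1 *: v).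
    exact: measurable_cVZ.
  exact: measurable_preimageT.
have := @sum_draws N _ (fun=> setT) (leqnn N) mA' (fun=> measurableT).
rewrite (_ : H `&` [set w | _] = H) => [->|]; last first.
  by apply/seteqP; split=> [w []//|w Hw]; split.
apply: eq_integral => w _; rewrite big_geq// mule1; congr (std_normal p _).
apply/funext => z /=; congr (A _).
rewrite scalerDr scalerA mulVf// scale1r -scalemxAr scalerA; congr (_ + _ *: _).
rewrite -[X in X^-1 * _](@sqr_sqrtr _ N%:R)// expr2 invfM -mulrA mulVf ?mulr1//.
by rewrite gt_eqF// sqrtr_gt0 ltr0n.
Qed.

End conditional_mean.

Section joint_law.
Context {R : realType} d (Omega : measurableType d) (P : probability Omega R).
Context (p : nat) (thetastar : 'cV[R]_p) (Sigma : 'M[R]_p) (N : nat -> nat).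
Context (x : nat -> nat -> Omega -> 'cV[R]_p).
Hypothesis N0 : forall t, (0 < N t)%N.
Hypothesis px : recursive_gaussian_process thetastar N x P Sigma.
Notation est := (estimate thetastar N x).
Notation S := (sqrtmx Sigma).
Notation std := (std_normal p).

Lemma measurable_estimate t : measurable_fun setT (est t).
Proof.
case: t => [|t]; first exact: measurable_cst.
by apply: measurable_cVZ; apply: measurable_cV_sum => i _; exact: px.1.
Qed.

Lemma past_estimate1 t A : (0 < t)%N -> measurable A ->
  past N x t [set w | A (est 1 w)].
Proof.
move=> t0 mA; rewrite /past; set G := [set E | _].
have mx (i : 'I_(N 0)) :
    measurable_fun (setT : set (g_sigma_algebraType G)) (x 0 i).
  move=> _ B mB; rewrite setTI; apply: sub_sigma_algebra.
  by exists 0, i, B.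
have : measurable_fun (setT : set (g_sigma_algebraType G)) (est 1).
  by apply: measurable_cVZ; apply: measurable_cV_sum => i _; exact: mx.
by move=> /(_ measurableT _ mA); rewrite setTI.
Qed.

Lemma past_setT t : past N x t setT.
Proof.
rewrite /past; set G := [set E | _].
exact: (@measurableT _ (g_sigma_algebraType G)).
Qed.

Lemma estimate_conditional_law t H A : past N x t H -> measurable H -> measurable A ->
  (P (H `&` [set w | A (est t.+1 w)]) =
  \int[P]_(w in H)
    std [set z | A (est t w + (Num.sqrt (N t)%:R)^-1 *: (S *m z))%R])%E.
Proof.
move=> pH mH mA.
have hx B : (forall i, measurable (B i)) ->
    (P (H `&` [set w | forall i, (i < N t)%N -> B i (x t i w)]) =
    \int[P]_(w in H) \prod_(i < N t) std [set z | B i (est t w + S *m z)%R])%E.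
  exact: px.2.
exact: (mean_draws mH (measurable_estimate t) (px.1 t) hx (N0 t) mA).
Qed.

Definition joint_map (a b : R) (q : 'cV[R]_p * 'cV[R]_p) :=
  (thetastar + a *: (S *m q.1), thetastar + a *: (S *m q.1) + b *: (S *m q.2)).

Lemma measurable_joint_map a b : measurable_fun setT (joint_map a b).
Proof.
have m1 : measurable_fun setT
    (fun q : 'cV[R]_p * 'cV[R]_p => thetastar + a *: (S *m q.1)).
  apply: measurable_cVD; first exact: measurable_cst.
  by apply: measurable_cVZ; exact: measurable_mulmx.
apply: measurable_fun_pair => //; apply: measurable_cVD => //.
by apply: measurable_cVZ; exact: measurable_mulmx.
Qed.

Lemma joint_law T C : (0 < T)%N -> measurable C ->
  P [set w | C (est 1 w, est T w)] =
  (std \x std)%E [set q | C (joint_map (Num.sqrt (N 0)%:R)^-1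
     (Num.sqrt (\sum_(1 <= t < T) (N t)%:R^-1)) q)].
Proof.
elim: T C => // T IH C _ mC.
set a := (Num.sqrt _)^-1; set b := Num.sqrt _.
have mpair : measurable_fun setT (fun w => (est 1 w, est T.+1 w)).
  by apply: measurable_fun_pair; exact: measurable_estimate.
suff : pushforward P (fun w => (est 1 w, est T.+1 w)) C =
       pushforward (std \x std)%E (joint_map a b) C by [].
have mjoint := measurable_joint_map a b.
apply: measure_eq_rectangles => //.
  by rewrite /= /pushforward preimage_setT probability_setT ltry.
move=> A1 A2 mA1 mA2.
have mH : measurable [set w | A1 (est 1 w)].
  by apply: measurable_preimageT mA1; exact: measurable_estimate.
have mf1 : measurable_fun setT
    (fun z : 'cV[R]_p => thetastar + a *: (S *m z)).
  apply: measurable_cVD; first exact: measurable_cst.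
  by apply: measurable_cVZ; exact: measurable_mulmx.
have mD : measurable [set z | A1 (thetastar + a *: (S *m z))].
  exact: measurable_preimageT.
have [T0|T0] := posnP T.
  have b0 : b = 0 by rewrite /b T0 big_geq// sqrtr0.
  transitivity (P (setT `&` [set w | (A1 `&` A2) (est 1 w)])).
    by rewrite /= /pushforward setTI T0.
  rewrite estimate_conditional_law//; [|exact: past_setT|exact: measurableI].
  rewrite /= integral_prob_cst.
  apply: etrans (esym (integral_indic_comp std mf1 (measurableI _ _ mA1 mA2))) _.
  apply: eq_integral => z _ /=; rewrite xsectionE b0.
  rewrite -(probability_cst std) /joint_map; congr (std _).
  by apply/funext => z' /=; rewrite scale0r addr0.
pose g := (Num.sqrt ((N T)%:R : R))^-1.
pose b' := Num.sqrt (\sum_(1 <= t < T) (N t)%:R^-1 : R).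
have bE : b = Num.sqrt (b' ^+ 2 + g ^+ 2).
  rewrite /b /b' /g exprVn !sqr_sqrtr ?ler0n ?sumr_ge0//.
  by rewrite big_nat_recr.
pose h (v : 'cV[R]_p) := std [set z | A2 (v + g *: (S *m z))].
have mh : measurable_fun setT h.
  apply: (measurable_section std
    (C := [set q : 'cV[R]_p * 'cV[R]_p | A2 (q.1 + g *: (S *m q.2))])).
  apply: measurable_preimageT mA2; apply: measurable_cVD => //.
  by apply: measurable_cVZ; exact: measurable_mulmx.
have h0 v : (0 <= h v)%E by [].
transitivity (\int[P]_(w in [set w | A1 (est 1 w)]) h (est T w))%E.
  rewrite /= /pushforward -estimate_conditional_law//; exact: past_estimate1.
have mpair' : measurable_fun setT (fun w => (est 1 w, est T w)).
  by apply: measurable_fun_pair; exact: measurable_estimate.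
have mY : measurable [set y : 'cV[R]_p * 'cV[R]_p | A1 y.1].
  exact: measurable_preimageT.
have mhY : measurable_fun [set y : 'cV[R]_p * 'cV[R]_p | A1 y.1] (fun y => h y.2).
  by apply: measurable_funTS; exact: (measurableT_comp mh measurable_snd).
transitivity (\int[pushforward P (fun w => (est 1 w, est T w))]_(y in
    [set y | A1 y.1]) h y.2)%E.
  by rewrite ge0_integral_pushforward.
transitivity (\int[pushforward (std \x std)%E (joint_map a b')]_(y in
    [set y | A1 y.1]) h y.2)%E.
  have mjoint' := measurable_joint_map a b'.
  by apply: eq_measure_integral => C' mC' _; exact: (IH C' T0 mC').
rewrite ge0_integral_pushforward//; last exact: measurable_joint_map.
pose D := [set z | A1 (thetastar + a *: (S *m z))].
have mhj : measurable_fun setT (fun q => h (joint_map a b' q).2).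
  apply: (measurableT_comp mh).
  exact: (measurableT_comp measurable_snd (measurable_joint_map a b')).
have mID : measurable_fun setT (fun z => (\1_D z : R)%:E).
  by apply/measurable_EFinP; exact: measurable_indic.
transitivity (\int[(std \x std)%E]_q ((\1_D q.1)%:E * h (joint_map a b' q).2))%E.
  rewrite integral_mkcond; apply: eq_integral => q _.
  by rewrite epatch_indic muleC.
rewrite (fubini_tonelli1 (fun q =>
  (\1_D q.1)%:E * h (joint_map a b' q).2)%E); last 2 first.
- by apply: emeasurable_funM => //; exact: (measurableT_comp mID measurable_fst).
- by move=> q; rewrite mule_ge0// lee_fin.
apply: eq_integral => z _ /=; rewrite /fubini_F/= ge0_integralZl//; last first.
  apply: (measurableT_comp mh); apply: measurable_cVD => //.
  by apply: measurable_cVZ; exact: measurable_mulmx.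
pose B := [set v | A2 (thetastar + a *: (S *m z) + S *m v)].
have mB : measurable B.
  apply: measurable_preimageT mA2; apply: measurable_cVD => //.
  exact: measurable_mulmx.
transitivity ((\1_D z)%:E * std [set v | B (b *: v)])%E.
  rewrite bE -std_normal_conv//; congr (_ * _)%E; apply: eq_integral => z2 _ /=.
  rewrite xsectionE; congr (std _); apply/funext => z3 /=.
  by rewrite /B/= mulmxDr !scalemxAr addrA.
rewrite xsectionE indicE; have [Dz|nDz] := pselect (D z).
  rewrite mem_set// mul1e; congr (std _); apply/funext => v /=.
  by rewrite /B/= -scalemxAr; apply/propext; split=> [|[]].
rewrite memNset// mul0e; apply: etrans (esym (measure0 std)) _.
by congr (std _); apply/seteqP; split=> // y [/nDz].
Qed.

End joint_law.

Section euclidean_norm.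
Context {R : realType}.

Lemma enorm_ge0 n (v : 'cV[R]_n) : 0 <= enorm v.
Proof. exact: sqrtr_ge0. Qed.

Lemma enormZ n a (v : 'cV[R]_n) : enorm (a *: v) = `|a| * enorm v.
Proof.
rewrite /enorm -sqrtr_sqr -sqrtrM ?sqr_ge0//; congr Num.sqrt.
by rewrite mulr_sumr; apply: eq_bigr => i _; rewrite mxE exprMn.
Qed.

Lemma enorm_gt0 n (v : 'cV[R]_n) : v != 0 -> 0 < enorm v.
Proof.
move=> v0; rewrite lt_def enorm_ge0 andbT -sqrf_eq0 enorm_sqr gt_eqF//.
exact: bform1_gt0.
Qed.

Lemma measurable_sqrt : measurable_fun setT (@Num.sqrt R).
Proof. exact: continuous_measurable_fun (@sqrt_continuous R). Qed.

Lemma measurable_inv : measurable_fun setT (fun x : R => x^-1).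
Proof.
have -> : [set: R] = [set x | x != 0] `|` [set 0].
  by apply/seteqP; split=> // x _; have [->|x0] := eqVneq x 0; [right|left].
apply/measurable_funU => //; first exact: open_measurable.
split; last exact: measurable_fun_set1.
apply: open_continuous_measurable_fun => //; apply/in_setP => x /= x0.
exact: inv_continuous.
Qed.

Lemma measurable_enorm n : measurable_fun setT (@enorm R n).
Proof.
apply: (measurableT_comp measurable_sqrt); apply: measurable_sum => i.
by apply: measurable_funX; exact: measurable_coord.
Qed.

Lemma measurable_cVscale d (X : measurableType d) n (a : X -> R) (f : X -> 'cV[R]_n) :
  measurable_fun setT a -> measurable_fun setT f ->
  measurable_fun setT (fun x => a x *: f x).
Proof.
move=> ma /measurable_fun_coordP mf.
apply/measurable_fun_coordP => i; under eq_fun do rewrite mxE.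
exact: measurable_funM.
Qed.

Lemma measurable_Phi : measurable_fun setT (@Phi R).
Proof.
have -> : @Phi R = fun x => normal_prob 0 1 [set y | `]-oo, 0%R]%classic (y - x)].
  apply/funext => x; rewrite /Phi; congr (normal_prob 0 1 _).
  by apply/seteqP; split=> y /=; rewrite !in_itv/= subr_le0.
apply: (measurable_section (normal_prob 0 1 : probability (measurableTypeR R) R)
  (C := [set q : measurableTypeR R * measurableTypeR R | `]-oo, 0%R]%classic (q.2 - q.1)])).
by apply: measurable_preimageT => //; exact: measurable_funB.
Qed.

Lemma le_Phi (x y : R) : x <= y -> (Phi x <= Phi y)%E.
Proof.
move=> xy; apply: le_measure; rewrite ?inE//.
by move=> z /=; rewrite !in_itv/= => /le_trans; exact.
Qed.

Lemma Phi_lt (x : R) : normal_prob 0 1 `]-oo, x[ = Phi x.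
Proof.
rewrite /Phi /normal_prob integral_itv_bndo_bndc//.
by apply: measurable_funTS; apply/measurable_EFinP; exact: measurable_normal_pdf.
Qed.

Lemma std_normal_dot n (a : 'cV[R]_n) (B : set (measurableTypeR R)) : measurable B ->
  std_normal n [set z | B (\sum_i a i ord0 * z i ord0)] =
  normal_prob 0 1 [set x | B (enorm a * x)].
Proof.
move=> mB.
have mI : measurable_fun setT (fun x : measurableTypeR R => (\1_B x : R)%:E).
  by apply/measurable_EFinP; exact: measurable_indic.
have I0 (x : measurableTypeR R) : (0 <= (\1_B x : R)%:E)%E by rewrite lee_fin.
have mdot : measurable_fun setT
    (fun z : 'cV[R]_n => \sum_i a i ord0 * z i ord0 : measurableTypeR R).
  by apply: measurable_sum => i; apply: measurable_funM => //; exact: measurable_coord.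
have mscale : measurable_fun setT
    (fun x : measurableTypeR R => enorm a * x : measurableTypeR R).
  exact: measurable_funM.
rewrite -(integral_indic_comp (std_normal n) mdot mB).
rewrite -(integral_indic_comp (normal_prob 0 1) mscale mB).
exact: (ge0_integral_std_normal_dot a mI I0).
Qed.

Lemma std_normal_dot_lt n (a : 'cV[R]_n) (r : R) : a != 0 ->
  std_normal n [set z | \sum_i a i ord0 * z i ord0 < r] = Phi (r / enorm a).
Proof.
move=> a0; have na := enorm_gt0 a0.
have mB : measurable (`]-oo, r[ : set (measurableTypeR R)) by exact: measurable_itv.
have := std_normal_dot a mB; rewrite -Phi_lt => h; apply: etrans (etrans h _).
  by congr (std_normal n _); apply/seteqP; split=> z /=; rewrite in_itv.
congr (normal_prob 0 1 _); apply/seteqP; split=> x /=;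
  by rewrite !in_itv/= ltr_pdivlMr// mulrC.
Qed.

Lemma std_normal_kernel n (A : 'M[R]_n) : A != 0 ->
  (std_normal n).-negligible [set z | A *m z = 0].
Proof.
move=> A0; have [i ai0] : exists i, (row i A)^T != 0.
  apply/existsP; apply: contraNT A0 => /existsPn h; apply/eqP/row_matrixP => i.
  by have := h i; rewrite negbK trmx_eq0 row0 => /eqP.
have na := enorm_gt0 ai0.
have m0 : measurable ([set 0] : set (measurableTypeR R)) by exact: measurable_set1.
have mdot : measurable_fun setT
    (fun z : 'cV[R]_n => \sum_j (row i A)^T j ord0 * z j ord0 : measurableTypeR R).
  by apply: measurable_sum => j; apply: measurable_funM => //; exact: measurable_coord.
exists [set z : 'cV[R]_n | \sum_j (row i A)^T j ord0 * z j ord0 = 0]; split.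
- exact: (measurable_preimageT mdot m0).
- apply: etrans (std_normal_dot (row i A)^T m0) _.
  have -> : [set x | [set 0] (enorm (row i A)^T * x)] = [set 0].
    apply/seteqP; split=> x /=; last by move=> ->; rewrite mulr0.
    by move/eqP; rewrite mulf_eq0 (gt_eqF na) => /eqP.
  by rewrite /normal_prob integral_set1.
- move=> z /= /matrixP /(_ i ord0); rewrite !mxE => Az; rewrite -[RHS]Az.
  by apply: eq_bigr => j _; rewrite !mxE.
Qed.

End euclidean_norm.

Section improvement.
Context {R : realType} (p : nat) (S : 'M[R]_p).
Hypotheses (pS : psdmx S) (S0 : S != 0).
Notation std := (std_normal p).

Definition improvement_cdf (X : 'cV[R]_p) : \bar R :=
  Phi (- (enorm X / (2 * enorm (S *m ((enorm X)^-1 *: X))))).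

Lemma measurable_improvement_cdf : measurable_fun setT improvement_cdf.
Proof.
apply: (measurableT_comp measurable_Phi); apply: measurableT_comp => //.
apply: measurable_funM; first exact: measurable_enorm.
apply: (measurableT_comp measurable_inv); apply: measurable_funM => //.
apply: (measurableT_comp (@measurable_enorm R p)); apply: measurable_mulmx.
apply: measurable_cVscale => //.
by apply: (measurableT_comp measurable_inv); exact: measurable_enorm.
Qed.

Lemma psd_mul_eq0 (z : 'cV[R]_p) : S *m (S *m z) = 0 -> S *m z = 0.
Proof.
move=> SSz; apply: bform1_eq0; rewrite bform_mull mulmx1 pS.1.
by rewrite /bform -mulmxA SSz mulmx0 mxE.
Qed.

Lemma closer_iff a k (z u : 'cV[R]_p) : 0 < a -> 0 < k ->
  (enorm (a *: (S *m z) + (k * a) *: u) < enorm (a *: (S *m z))) =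
  (\sum_i (S *m u) i ord0 * z i ord0 < - (k * enorm u ^+ 2 / 2)).
Proof.
move=> a0 k0; rewrite -(@ltr_pXn2r _ 2)// ?nnegrE ?enorm_ge0//.
rewrite !enorm_sqr !(bformDl, bformDr, bformZl, bformZr) -bform1E.
rewrite (bformC u (S *m z) (trmx1 _ _)).
have -> : bform 1%:M (S *m z) u = bform S z u by rewrite bform_mull mulmx1 pS.1.
have -> : bform 1%:M (S *m u) z = bform S z u.
  by rewrite bform_mull mulmx1 pS.1 (bformC u z pS.1).
have ak2 : 0 < 2 * k * a * a by rewrite !mulr_gt0.
rewrite -subr_lt0 -[RHS]subr_lt0 -[RHS](pmulr_rlt0 _ ak2).
by congr (_ < 0); field.
Qed.

Lemma enorm_mulmx_direction k (u : 'cV[R]_p) : 0 < k -> u != 0 ->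
  enorm (S *m ((enorm (k *: u))^-1 *: (k *: u))) = enorm (S *m u) / enorm u.
Proof.
move=> k0 u0; have nu := enorm_gt0 u0.
rewrite -!scalemxAr !enormZ normfV normrM normr_id (gtr0_norm k0).
rewrite (ger0_norm (enorm_ge0 u)).
by field; rewrite !gt_eqF.
Qed.

Lemma closer_prob a k (z2 : 'cV[R]_p) : 0 < a -> 0 < k -> S *m z2 != 0 ->
  std [set z1 | enorm (a *: (S *m z1) + (k * a) *: (S *m z2)) <
                enorm (a *: (S *m z1))] =
  improvement_cdf (k *: (S *m z2)).
Proof.
move=> a0 k0; set u := S *m z2 => u0.
under eq_set do rewrite closer_iff//.
have Su0 : S *m u != 0 by apply: contra u0 => /eqP/psd_mul_eq0/eqP.
have nu := enorm_gt0 u0; have nSu := enorm_gt0 Su0.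
rewrite std_normal_dot_lt// /improvement_cdf; congr Phi.
rewrite enorm_mulmx_direction// enormZ (gtr0_norm k0).
by field; rewrite !gt_eqF.
Qed.

Lemma closer_prob_integral a k : 0 < a -> 0 < k ->
  ((std \x std) [set q | (enorm (a *: (S *m q.1) + (k * a) *: (S *m q.2)) <
                          enorm (a *: (S *m q.1)))%R] =
  \int[std]_z improvement_cdf (k *: (S *m z))%R)%E.
Proof.
move=> a0 k0; set Q := [set q | _].
have mSz (X : 'cV[R]_p * 'cV[R]_p -> 'cV[R]_p) c : measurable_fun setT X ->
    measurable_fun setT (fun q => c *: (S *m X q)).
  by move=> mX; apply: measurable_cVZ; exact: measurable_mulmx.
have mQ : measurable Q.
  rewrite -[Q]setTI; apply: measurable_fun_ltr => //;
    apply: (measurableT_comp (@measurable_enorm R p)); last exact: mSz.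
  by apply: measurable_cVD; exact: mSz.
rewrite product_measure_swap//; apply: ae_eq_integral => //.
- apply: (measurable_section std (C := [set q | Q (q.2, q.1)])).
  apply: measurable_preimageT mQ.
  exact: (measurable_fun_pair measurable_snd measurable_fst).
- apply: (measurableT_comp measurable_improvement_cdf).
  by apply: measurable_cVZ; exact: measurable_mulmx.
- apply: negligibleS (std_normal_kernel S0) => z /= h; apply/eqP/negPn/negP => Sz.
  by apply: h => _; exact: closer_prob.
Qed.

Lemma enorm_direction_sqr (u : 'cV[R]_p) : u != 0 ->
  (enorm (S *m u) / enorm u) ^+ 2 = bform (S *m S) u u / bform 1%:M u u.
Proof.
by move=> u0; rewrite exprMn exprVn !enorm_sqr bform_mulr bform_mull mul1mx pS.1.
Qed.

Lemma improvement_cdf_ge k l (z : 'cV[R]_p) : 0 < k -> 0 < l ->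
  l * bform 1%:M (S *m z) (S *m z) <= bform (S *m S) (S *m z) (S *m z) ->
  (Phi (- (enorm (k *: (S *m z)) / (2 * Num.sqrt l))) <=
   improvement_cdf (k *: (S *m z)))%E.
Proof.
move=> k0 l0 h; apply: le_Phi; rewrite lerN2.
have [->|u0] := eqVneq (S *m z) 0.
  by rewrite scaler0 -(scale0r 0) enormZ normr0 !mul0r.
rewrite enorm_mulmx_direction// ler_wpM2l ?enorm_ge0//.
have sl : 0 < Num.sqrt l by rewrite sqrtr_gt0.
have r0 : 0 <= enorm (S *m (S *m z)) / enorm (S *m z) by rewrite divr_ge0 ?enorm_ge0.
have lr : Num.sqrt l <= enorm (S *m (S *m z)) / enorm (S *m z).
  rewrite -(ger0_norm r0) -sqrtr_sqr ler_wsqrtr// enorm_direction_sqr//.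
  by rewrite ler_pdivlMr// bform1_gt0.
have r0' := lt_le_trans sl lr.
by rewrite lef_pV2 ?posrE ?(mulr_gt0 _ r0') ?(mulr_gt0 _ sl)// ler_pM2l.
Qed.

Lemma improvement_cdf_le k l (z : 'cV[R]_p) : 0 < k ->
  bform (S *m S) (S *m z) (S *m z) <= l * bform 1%:M (S *m z) (S *m z) ->
  (improvement_cdf (k *: (S *m z)) <=
   Phi (- (enorm (k *: (S *m z)) / (2 * Num.sqrt l))))%E.
Proof.
move=> k0 h; apply: le_Phi; rewrite lerN2.
have [->|u0] := eqVneq (S *m z) 0.
  by rewrite scaler0 -(scale0r 0) enormZ normr0 !mul0r.
rewrite enorm_mulmx_direction// ler_wpM2l ?enorm_ge0//.
have Su0 : S *m (S *m z) != 0 by apply: contra u0 => /eqP/psd_mul_eq0/eqP.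
have r0 : 0 < enorm (S *m (S *m z)) / enorm (S *m z) by rewrite divr_gt0 ?enorm_gt0.
have lr : enorm (S *m (S *m z)) / enorm (S *m z) <= Num.sqrt l.
  rewrite -(gtr0_norm r0) -sqrtr_sqr ler_wsqrtr// enorm_direction_sqr//.
  by rewrite ler_pdivrMr// bform1_gt0.
have sl := lt_le_trans r0 lr.
by rewrite lef_pV2 ?posrE ?(mulr_gt0 _ r0) ?(mulr_gt0 _ sl)// ler_pM2l.
Qed.

End improvement.

Lemma ge0_integral_mvnormal0 {R : realType} p (Sigma : 'M[R]_p) (c : R)
    (f : 'cV[R]_p -> \bar R) :
  psdmx Sigma -> 0 <= c -> measurable_fun setT f -> (forall X, 0 <= f X)%E ->
  (\int[mvnormal 0 (c *: Sigma)]_X f X =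
   \int[std_normal p]_z f (Num.sqrt c *: (sqrtmx Sigma *m z))%R)%E.
Proof.
move=> pS c0 mf f0; rewrite ge0_integral_distribution//.
apply: eq_integral => z _; congr f.
by rewrite /= /affine_cV add0r sqrtmxZ// -scalemxAl.
Qed.

Unset Implicit Arguments.

Theorem theorem5 (R : realType) (d : measure_display) (Omega : measurableType d)
    (P : probability Omega R) (p : nat)
    (thetastar : 'cV[R]_p) (Sigma : 'M[R]_p)
    (n : nat) (c : nat -> R) (N : nat -> nat)
    (x : nat -> nat -> Omega -> 'cV[R]_p) (T : nat) :
  psdmx Sigma -> Sigma != 0 ->
  (0 < n)%N -> N 0%N = n ->
  (forall t, (1 <= t)%N -> 0 < c t /\ (N t)%:R = c t * n%:R) ->
  recursive_gaussian_process thetastar N x P Sigma ->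
  (2 <= T)%N ->
  let PT := prob_improvement thetastar N x P T in
  let lawX := mvnormal 0 (\sum_(1 <= t < T) (c t)^-1 *: Sigma) in
  (PT = \int[lawX]_X
          Phi (- (enorm X /
                  (2 * enorm (sqrtmx Sigma *m ((enorm X)^-1 *: X)))))%R)%E /\
  (forall lmin lmax : R,
     is_min_eigenvalue Sigma lmin -> is_max_eigenvalue Sigma lmax ->
     (0 < lmin ->
       (\int[lawX]_X Phi (- (enorm X / (2 * Num.sqrt lmin)))%R <= PT)%E) /\
     (PT <= \int[lawX]_X Phi (- (enorm X / (2 * Num.sqrt lmax)))%R)%E).
Proof.
move=> pSigma Sigma0 n0 N0n cN px T2.
have nR : 0 < n%:R :> R by rewrite ltr0n.
have N0 t : (0 < N t)%N.
  case: t => [|t]; first by rewrite N0n.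
  by have [c0 Nt] := cN t.+1 isT; rewrite -(ltr0n R) Nt mulr_gt0.
have [pS SS] := sqrtmxP pSigma.
have S0 : sqrtmx Sigma != 0.
  by apply: contra Sigma0 => /eqP S0; rewrite -SS S0 mulmx0.
pose kappa : R := \sum_(1 <= t < T) (c t)^-1.
have kappa0 : 0 < kappa.
  rewrite /kappa big_ltn// ltr_wpDr//; last by rewrite invr_gt0; have [] := cN 1 isT.
  rewrite big_nat sumr_ge0// => t /andP[t1 _]; rewrite invr_ge0 ltW//.
  by have [] := cN t (ltnW t1).
pose k := Num.sqrt kappa; have k0 : 0 < k by rewrite sqrtr_gt0.
pose a : R := (Num.sqrt (N 0)%:R)^-1.
have a0 : 0 < a by rewrite invr_gt0 sqrtr_gt0 ltr0n N0n.
have bE : Num.sqrt (\sum_(1 <= t < T) (N t)%:R^-1) = k * a.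
  rewrite /k /a N0n -sqrtrV ?ler0n// -sqrtrM ?ltW//; congr Num.sqrt.
  rewrite /kappa mulr_suml; apply: eq_big_nat => t /andP[t1 _].
  by have [_ ->] := cN t t1; rewrite invfM.
move=> PT lawX.
have intE f : measurable_fun setT f -> (forall X, 0 <= f X)%E ->
    (\int[lawX]_X f X = \int[std_normal p]_z f (k *: (sqrtmx Sigma *m z))%R)%E.
  by move=> mf f0; rewrite /lawX -scaler_suml ge0_integral_mvnormal0 ?ltW.
have PTE : (PT = \int[std_normal p]_z
    improvement_cdf (sqrtmx Sigma) (k *: (sqrtmx Sigma *m z))%R)%E.
  rewrite -(closer_prob_integral pS S0 a0 k0) -bE.
  pose C := [set y : 'cV[R]_p * 'cV[R]_p |
    enorm (y.2 - thetastar) < enorm (y.1 - thetastar)].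
  have mC : measurable C.
    rewrite -[C]setTI; apply: measurable_fun_ltr => //;
      apply: (measurableT_comp (@measurable_enorm R p)); exact: measurable_cVD.
  have := joint_law N0 px (ltnW T2) mC => h; apply: etrans h _.
  congr (product_measure1 _ _ _); apply/funext => q; rewrite /C/=.
  have th v : thetastar + v - thetastar = v by rewrite addrAC subrr add0r.
  by rewrite th -(addrA thetastar) th.
have Phi_ge0 r : (0 <= @Phi R r)%E by exact: measure_ge0.
have mcdf := measurable_improvement_cdf (sqrtmx Sigma).
have mPhi l : measurable_fun setT
    (fun X : 'cV[R]_p => Phi (- (enorm X / (2 * Num.sqrt l)))).
  apply: (measurableT_comp measurable_Phi); apply: measurableT_comp => //.
  by apply: measurable_funM => //; exact: measurable_enorm.
have msub (f : 'cV[R]_p -> \bar R) : measurable_fun setT f ->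
    measurable_fun setT (fun z => f (k *: (sqrtmx Sigma *m z))).
  move=> mf; apply: (measurableT_comp mf); apply: measurable_cVZ.
  exact: measurable_mulmx.
have E1 := intE _ mcdf (fun=> Phi_ge0 _).
split; first by rewrite PTE -E1 /improvement_cdf; reflexivity.
move=> lmin lmax minl maxl; split=> [lmin0|].
  rewrite (intE _ (mPhi lmin) (fun=> Phi_ge0 _)) PTE.
  apply: ge0_le_integral;
    [exact: measurableT|by move=> z _; exact: Phi_ge0|
     exact: (msub _ (mPhi lmin))|exact: (msub _ mcdf)|move=> z _].
  apply: improvement_cdf_ge => //.
  by rewrite SS; apply: bform_ge_min_eigenvalue => //; exact: pSigma.1.
rewrite (intE _ (mPhi lmax) (fun=> Phi_ge0 _)) PTE.
apply: ge0_le_integral;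
  [exact: measurableT|by move=> z _; exact: Phi_ge0|exact: (msub _ mcdf)|
   exact: (msub _ (mPhi lmax))|move=> z _].
apply: improvement_cdf_le => //.
by rewrite SS; apply: bform_le_max_eigenvalue => //; exact: pSigma.1.
Qed.
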